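(* Let $(Z,Z_{ac},e)$ be an accretive archimedean matrix-order unit space. Then there exist a Hilbert space $H$ and a real-complete order embedding $\phi:Z\to B(H)$ with $\phi(e)=I_H$. Moreover, $\phi$ is completely isometric with respect to the norms on $M_n(Z)$ given by $$\|z\|_n=\inf\left\{t>0:\ t\,e\otimes I_{2n}-\begin{bmatrix}0&2z\\0&0\end{bmatrix}\in Z_{ac}^{2n}\right\},$$ i.e. $\|\phi^{(n)}(z)\|_{B(H^n)}=\|z\|_n$ for all $n$ and $z\in M_n(Z)$.
   Context: For a complex vector space $Z$, $M_n(Z)$ denotes the $n\times n$ matrices over $Z$; for a scalar matrix $X\in M_{n,k}$ and $A\in M_n(Z)$, $X^*AX$ is defined by matrix multiplication. A cone is a set $C$ with $C+C\subseteq C$ and $tC\subseteq C$ for $t\ge0$. A matrix cone in $Z$ is a sequence of cones $C_n\subseteq M_n(Z)$ with $X^*C_nX\subseteq C_k$ for all $X\in M_{n,k}$. It is $\mathbb{C}$-proper if $C_1\cap -C_1\cap iC_1\cap -iC_1=\{0\}$; then $(Z,Z_{ac})$, $Z_{ac}=\{Z_{ac}^n\}$, is called an accretive matrix-ordered vector space, and one sets $Z_{sa}^n=iZ_{ac}^n\cap -iZ_{ac}^n$, $Z_+^n=Z_{sa}^n\cap Z_{ac}^n$. For $e\in Z$, $e\otimes I_n$ is the diagonal matrix in $M_n(Z)$ with all diagonal entries $e$. An element $e\in Z_{sa}^1$ is an accretive matrix-order unit if for every $n$ and $z\in M_n(Z)$ there is $t>0$ with $te\otimes I_n+z\in Z_{ac}^n$;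 it is archimedean if $te\otimes I_n+z\in Z_{ac}^n$ for all $t>0$ implies $z\in Z_{ac}^n$. Then $(Z,Z_{ac},e)$ is an accretive archimedean matrix-order unit space. For a Hilbert space $H$, $M_n(B(H))=B(H^n)$ carries the accretive cones $\{T:\operatorname{Re}(T)=\frac12(T+T^* )\ge0\}$. A linear map $\phi$ is real-completely positive if $\phi^{(n)}$ (entrywise application) maps $Z_{ac}^n$ into the target's accretive cone for all $n$; it is a real-complete order embedding if injective and both $\phi$ and $\phi^{-1}$ (on the range) are real-completely positive. *)

(* Defs.v *)
From Stdlib Require Import Reals.
From mathcomp Require Import ssreflect ssrfun ssrbool eqtype ssrnat seq fintype bigop.

Set Implicit Arguments.
Unset Strict Implicit.

Local Open Scope R_scope.

Record Cx := mkC { cre : R; cim : R }.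
Definition C0 : Cx := mkC 0 0.
Definition C1 : Cx := mkC 1 0.
Definition Ci : Cx := mkC 0 1.
Definition RtoC (r : R) : Cx := mkC r 0.
Definition Cplus (a b : Cx) : Cx := mkC (cre a + cre b) (cim a + cim b).
Definition Cmult (a b : Cx) : Cx :=
  mkC (cre a * cre b - cim a * cim b) (cre a * cim b + cim a * cre b).
Definition Copp (a : Cx) : Cx := mkC (- cre a) (- cim a).
Definition Cconj (a : Cx) : Cx := mkC (cre a) (- cim a).

Record CVec := {
  vcar :> Type;
  vadd : vcar -> vcar -> vcar;
  vzero : vcar;
  vopp : vcar -> vcar;
  vscal : Cx -> vcar -> vcar;
  vaddA : forall x y z, vadd x (vadd y z) = vadd (vadd x y) z;
  vaddC : forall x y, vadd x y = vadd y x;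
  vadd0 : forall x, vadd x vzero = x;
  vaddN : forall x, vadd x (vopp x) = vzero;
  vscal1 : forall x, vscal C1 x = x;
  vscalA : forall a b x, vscal a (vscal b x) = vscal (Cmult a b) x;
  vscalDr : forall a x y, vscal a (vadd x y) = vadd (vscal a x) (vscal a y);
  vscalDl : forall a b x, vscal (Cplus a b) x = vadd (vscal a x) (vscal b x)
}.

Record Hilb := {
  hvec :> CVec;
  hinner : hvec -> hvec -> Cx;
  hinnerD : forall x y z, hinner (vadd x y) z = Cplus (hinner x z) (hinner y z);
  hinnerZ : forall a x y, hinner (vscal a x) y = Cmult a (hinner x y);
  hinnerC : forall x y, hinner y x = Cconj (hinner x y);
  hinner_ge0 : forall x, 0 <= cre (hinner x x);
  hinner_eq0 : forall x, hinner x x = C0 -> x = vzero hvec;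
  hcomplete : forall u : nat -> hvec,
    (forall eps, 0 < eps -> exists N, forall m k, (N <= m)%nat -> (N <= k)%nat ->
        sqrt (cre (hinner (vadd (u m) (vopp (u k))) (vadd (u m) (vopp (u k))))) < eps) ->
    exists l, forall eps, 0 < eps -> exists N, forall m, (N <= m)%nat ->
        sqrt (cre (hinner (vadd (u m) (vopp l)) (vadd (u m) (vopp l)))) < eps
}.

Definition hnorm (H : Hilb) (x : H) : R := sqrt (cre (hinner x x)).

Definition bounded_linear (H : Hilb) (T : H -> H) : Prop :=
  (forall x y, T (vadd x y) = vadd (T x) (T y)) /\
  (forall a x, T (vscal a x) = vscal a (T x)) /\
  (exists M, forall x, hnorm (T x) <= M * hnorm x).

Definition mat (V : Type) (n : nat) := 'I_n -> 'I_n -> V.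

Section MatOps.
Variable Z : CVec.
Definition madd n (A B : mat Z n) : mat Z n := fun i j => vadd (A i j) (B i j).
Definition mscal n (a : Cx) (A : mat Z n) : mat Z n := fun i j => vscal a (A i j).
Definition mopp n (A : mat Z n) : mat Z n := fun i j => vopp (A i j).
Definition m1 (a : Z) : mat Z 1%N := fun _ _ => a.
Definition eI (e : Z) n : mat Z n := fun i j => if i == j then e else vzero Z.
Definition congr n k (X : 'I_n -> 'I_k -> Cx) (A : mat Z n) : mat Z k :=
  fun p q => \big[@vadd Z/vzero Z]_(i < n) \big[@vadd Z/vzero Z]_(j < n)
                vscal (Cmult (Cconj (X i p)) (X j q)) (A i j).
Definition block2 n (z : mat Z n) : mat Z (n + n) :=
  fun i j => match split i, split j with
             | inl i', inr j' => vscal (RtoC 2) (z i' j')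
             | _, _ => vzero Z
             end.
End MatOps.
Arguments eI {Z} e n _ _.
Arguments m1 {Z} a _ _.

Definition is_cone (Z : CVec) n (C : mat Z n -> Prop) : Prop :=
  (forall A B, C A -> C B -> C (madd A B)) /\
  (forall (t : R) A, 0 <= t -> C A -> C (mscal (RtoC t) A)).

Definition matrix_cone (Z : CVec) (K : forall n, mat Z n -> Prop) : Prop :=
  (forall n, (0 < n)%N -> is_cone (K n)) /\
  (forall n k, (0 < n)%N -> (0 < k)%N -> forall (X : 'I_n -> 'I_k -> Cx) (A : mat Z n),
       K n A -> K k (congr X A)).

Definition C_proper (Z : CVec) (K : forall n, mat Z n -> Prop) : Prop :=
  forall a : mat Z 1,
    (K 1%N a /\ (exists c, K 1%N c /\ a = mscal (Copp C1) c)
           /\ (exists c, K 1%N c /\ a = mscal Ci c)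
           /\ (exists c, K 1%N c /\ a = mscal (Copp Ci) c))
    <-> a = m1 (vzero Z).

Definition self_adjoint1 (Z : CVec) (K : forall n, mat Z n -> Prop) (e : Z) : Prop :=
  (exists c, K 1%N c /\ m1 e = mscal Ci c) /\ (exists c, K 1%N c /\ m1 e = mscal (Copp Ci) c).

Definition accretive_unit (Z : CVec) (K : forall n, mat Z n -> Prop) (e : Z) : Prop :=
  self_adjoint1 K e /\
  forall n, (0 < n)%N -> forall z : mat Z n,
    exists t : R, 0 < t /\ K n (madd (mscal (RtoC t) (eI e n)) z).

Definition archimedean (Z : CVec) (K : forall n, mat Z n -> Prop) (e : Z) : Prop :=
  forall n, (0 < n)%N -> forall z : mat Z n,
    (forall t : R, 0 < t -> K n (madd (mscal (RtoC t) (eI e n)) z)) -> K n z.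

Definition opapp (H : Hilb) n (T : 'I_n -> 'I_n -> H -> H) (x : 'I_n -> H) : 'I_n -> H :=
  fun i => \big[@vadd H/vzero H]_(j < n) T i j (x j).

Definition op_accretive (H : Hilb) n (T : 'I_n -> 'I_n -> H -> H) : Prop :=
  forall x : 'I_n -> H,
    0 <= \big[Rplus/0]_(i < n) cre (hinner (opapp T x i) (x i)).

Definition normsq_n (H : Hilb) n (x : 'I_n -> H) : R :=
  \big[Rplus/0]_(i < n) cre (hinner (x i) (x i)).

Definition op_norm_set (H : Hilb) n (T : 'I_n -> 'I_n -> H -> H) (s : R) : Prop :=
  exists x : 'I_n -> H, normsq_n x <= 1 /\ s = sqrt (normsq_n (opapp T x)).

Definition ampl (Z : CVec) (H : Hilb) (phi : Z -> H -> H) n (z : mat Z n)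
  : 'I_n -> 'I_n -> H -> H := fun i j => phi (z i j).

Definition is_glb (E : R -> Prop) (m : R) : Prop :=
  (forall x, E x -> m <= x) /\ (forall b, (forall x, E x -> b <= x) -> b <= m).

Definition unit_norm_set (Z : CVec) (K : forall n, mat Z n -> Prop) (e : Z) n
  (z : mat Z n) (t : R) : Prop :=
  0 < t /\ K (n + n)%N (madd (mscal (RtoC t) (eI e (n + n)%N)) (mopp (block2 z))).

Definition clinear (Z : CVec) (H : Hilb) (phi : Z -> H -> H) : Prop :=
  (forall z w h, phi (vadd z w) h = vadd (phi z h) (phi w h)) /\
  (forall a z h, phi (vscal a z) h = vscal a (phi z h)).

Definition real_complete_order_embedding (Z : CVec) (K : forall n, mat Z n -> Prop)
  (H : Hilb) (phi : Z -> H -> H) : Prop :=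
  (forall z w, (forall h, phi z h = phi w h) -> z = w) /\
  (forall n, (0 < n)%N -> forall z : mat Z n, K n z -> op_accretive (ampl phi z)) /\
  (forall n, (0 < n)%N -> forall z : mat Z n, op_accretive (ampl phi z) -> K n z).

Definition complete_isometry (Z : CVec) (K : forall n, mat Z n -> Prop) (e : Z)
  (H : Hilb) (phi : Z -> H -> H) : Prop :=
  forall n, (0 < n)%N -> forall z : mat Z n,
    exists r : R, is_lub (op_norm_set (ampl phi z)) r /\ is_glb (unit_norm_set K e z) r.

(* Main.v *)
Require Import Defs.
From HB Require Import structures.
From Stdlib Require Import Reals Lra.
From mathcomp Require Import ssreflect ssrfun ssrbool eqtype ssrnat seq choice fintype bigop.
From mathcomp Require Import boolp classical_sets.
(* Repeated so that [C0] and [C1] are not those of [Reals]. *)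
Require Import Defs.

(* If [z] is not in [K n], a Hahn-Banach argument (Zorn's lemma on cones) gives
   a real functional [f] on [M_n(Z)] that is nonnegative on [K n] and negative
   at [z].  Let [g] be the complex-linear functional with real part [f].  The
   forms [(x, y) |-> g (x^* (.) y)] on [C^n] turn [f >= 0] into complete
   positivity, since [sum_ij x_i^* A_ij x_j = X^* A X].  Gram-Schmidt for the
   form of [e], whose null vectors are null for all forms, compresses them to a
   unital completely positive map into matrices that detects [z].  The Hilbert
   direct sum of these maps over all pairs [(n, z)] with [z] outside [K n] is
   the embedding; it is bounded, and isometric, because accretivity of
   [t I - [0 2T; 0 0]] means exactly [|T| <= t]. *)

Set Implicit Arguments.
Unset Strict Implicit.

Local Open Scope R_scope.

(** * Complex scalars and vectors *)

(** The cones are stable only under nonnegative real scalars, so the separation takes place over the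
    reals. No topology is available there: the archimedean axiom replaces closedness, because a [z]
    outside [K n] leaves some [t > 0] with [t e + z] still outside, and a functional that is
    nonpositive at [t e + z] and equal to 1 at the unit is at most [- t] at [z]. This margin gives
    the strict sign. Detecting one matrix involves only finitely many vectors, so each compression
    lives on a finite-dimensional space and the completion of a quotient in the usual GNS
    construction is avoided. The price is a direct sum over an index set that is in general
    uncountable, hence unordered sums. For it to carry bounded operators, the bound on the image of
    [z] must not depend on the representation; it comes from the order unit alone. *)

Lemma Cx_eq (a b : Cx) : cre a = cre b -> cim a = cim b -> a = b.
Proof. by case: a b => [? ?] [? ?] /= -> ->. Qed.

Definition Cminus (a b : Cx) : Cx := Cplus a (Copp b).

Lemma Cx_ring_theory : ring_theory C0 C1 Cplus Cmult Cminus Copp (@eq Cx).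
Proof. by split=> *; apply: Cx_eq => /=; ring. Qed.
Add Ring Cx_ring : Cx_ring_theory.

(** * Big-operator structures on scalars and vectors *)

Lemma CplusA : associative Cplus. Proof. by move=> a b c; ring. Qed.
Lemma CplusC : commutative Cplus. Proof. by move=> a b; ring. Qed.
Lemma Cplus0x : left_id C0 Cplus. Proof. by move=> a; ring. Qed.
HB.instance Definition _ := Monoid.isComLaw.Build Cx C0 Cplus CplusA CplusC Cplus0x.
Lemma Cmult0x : left_zero C0 Cmult. Proof. by move=> a; ring. Qed.
Lemma Cmultx0 : right_zero C0 Cmult. Proof. by move=> a; ring. Qed.
HB.instance Definition _ := Monoid.isMulLaw.Build Cx C0 Cmult Cmult0x Cmultx0.
Lemma CmultDl : left_distributive Cmult Cplus. Proof. by move=> a b c; ring. Qed.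
Lemma CmultDr : right_distributive Cmult Cplus. Proof. by move=> a b c; ring. Qed.
HB.instance Definition _ := Monoid.isAddLaw.Build Cx Cmult Cplus CmultDl CmultDr.

Lemma RplusA : associative Rplus. Proof. by move=> a b c; ring. Qed.
Lemma RplusC : commutative Rplus. Proof. by move=> a b; ring. Qed.
Lemma Rplus0x : left_id 0 Rplus. Proof. by move=> a; ring. Qed.
HB.instance Definition _ := Monoid.isComLaw.Build R 0 Rplus RplusA RplusC Rplus0x.
Lemma Rmult0x : left_zero 0 Rmult. Proof. by move=> a; ring. Qed.
Lemma Rmultx0 : right_zero 0 Rmult. Proof. by move=> a; ring. Qed.
HB.instance Definition _ := Monoid.isMulLaw.Build R 0 Rmult Rmult0x Rmultx0.
Lemma RmultDl : left_distributive Rmult Rplus. Proof. by move=> a b c; ring. Qed.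
Lemma RmultDr : right_distributive Rmult Rplus. Proof. by move=> a b c; ring. Qed.
HB.instance Definition _ := Monoid.isAddLaw.Build R Rmult Rplus RmultDl RmultDr.

Lemma vadd0x (Z : CVec) : left_id (vzero Z) (@vadd Z).
Proof. by move=> x; rewrite vaddC vadd0. Qed.
HB.instance Definition _ (Z : CVec) :=
  Monoid.isComLaw.Build Z (vzero Z) (@vadd Z) (@vaddA Z) (@vaddC Z) (@vadd0x Z).

Notation "\sumC_ ( i < n ) F" := (\big[Cplus/C0]_(i < n) F%R)
  (at level 41, F at level 41, i, n at level 50, format "\sumC_ ( i  <  n )  F").
Notation "\sumR_ ( i < n ) F" := (\big[Rplus/0]_(i < n) F%R)
  (at level 41, F at level 41, i, n at level 50, format "\sumR_ ( i  <  n )  F").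
Notation "\sumR_ ( i <- r ) F" := (\big[Rplus/0]_(i <- r) F%R)
  (at level 41, F at level 41, i, r at level 50, format "\sumR_ ( i  <-  r )  F").
Notation "\sumV_ ( i < n ) F" := (\big[@vadd _/vzero _]_(i < n) F%R)
  (at level 41, F at level 41, i, n at level 50, format "\sumV_ ( i  <  n )  F").

Section Vec.
Variable Z : CVec.
Implicit Types (x y : Z) (a b : Cx).

Lemma vadd_cancel x y z : vadd x y = vadd x z -> y = z.
Proof.
move=> h; rewrite -(vadd0x y) -(vadd0x z) -(vaddN x) (vaddC x (vopp x)).
by rewrite -!vaddA h.
Qed.

Lemma vscal0 x : vscal C0 x = vzero Z.
Proof.
apply: (@vadd_cancel (vscal C0 x)); rewrite -vscalDl vadd0; congr vscal.
by apply: Cx_eq => /=; ring.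
Qed.

Lemma vscalx0 a : vscal a (vzero Z) = vzero Z.
Proof. by rewrite -(vscal0 (vzero Z)) vscalA; congr vscal; ring. Qed.

Lemma voppE x : vopp x = vscal (Copp C1) x.
Proof.
apply: (@vadd_cancel x); rewrite vaddN -{1}(vscal1 x) -vscalDl -(vscal0 x).
by congr vscal; ring.
Qed.

(** * Linear identities by reflection *)

Inductive vexp : Type :=
  | VAtom of nat | VZero | VAdd of vexp & vexp | VOpp of vexp | VScal of Cx & vexp.

Fixpoint vden (env : seq Z) (t : vexp) : Z :=
  match t with
  | VAtom i => nth (vzero Z) env i
  | VZero => vzero Z
  | VAdd t1 t2 => vadd (vden env t1) (vden env t2)
  | VOpp t1 => vopp (vden env t1)
  | VScal a t1 => vscal a (vden env t1)
  end.

Fixpoint vcoef (t : vexp) (i : nat) : Cx :=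
  match t with
  | VAtom j => if Nat.eqb i j then C1 else C0
  | VZero => C0
  | VAdd t1 t2 => Cplus (vcoef t1 i) (vcoef t2 i)
  | VOpp t1 => Copp (vcoef t1 i)
  | VScal a t1 => Cmult a (vcoef t1 i)
  end.

Fixpoint vlin (env : seq Z) (c : nat -> Cx) : Z :=
  if env is x :: env' then vadd (vscal (c 0%N) x) (vlin env' (fun i => c i.+1))
  else vzero Z.

(** A recursive conjunction instead of a bounded quantifier, so that [cbn] and [split] leave one
    scalar goal per atom. *)
Fixpoint coefs_eq (n : nat) (c d : nat -> Cx) : Prop :=
  if n is m.+1 then c 0%N = d 0%N /\ coefs_eq m (fun i => c i.+1) (fun i => d i.+1)
  else True.

Lemma vlin_eq env c d : coefs_eq (size env) c d -> vlin env c = vlin env d.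
Proof. by elim: env c d => //= x env IH c d [-> /IH ->]. Qed.

Lemma coefs_eqW n c d : (forall i, c i = d i) -> coefs_eq n c d.
Proof. by elim: n c d => //= n IH c d h; split=> //; apply: IH. Qed.

Lemma vlin0 env c : (forall i, c i = C0) -> vlin env c = vzero Z.
Proof. by elim: env c => //= x env IH c h; rewrite h vscal0 vadd0x IH. Qed.

Lemma vlinD env c d :
  vlin env (fun i => Cplus (c i) (d i)) = vadd (vlin env c) (vlin env d).
Proof.
elim: env c d => [|x env IH] c d /=; first by rewrite vadd0.
rewrite IH vscalDl -!vaddA; congr vadd.
by rewrite !vaddA; congr vadd; rewrite vaddC.
Qed.

Lemma vlinZ env a c : vlin env (fun i => Cmult a (c i)) = vscal a (vlin env c).
Proof.
by elim: env c => [|x env IH] c /=; rewrite ?vscalx0 // IH vscalDr vscalA.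
Qed.

Lemma vden_lin env t : vden env t = vlin env (vcoef t).
Proof.
elim: t => [i||t1 IH1 t2 IH2|t IH|a t IH] /=.
- elim: env i => [|x env IH] [|i] //=.
  + by rewrite vscal1 vlin0 ?vadd0.
  + by rewrite vscal0 vadd0x.
- by rewrite vlin0.
- by rewrite IH1 IH2 -vlinD.
- rewrite voppE IH -vlinZ; apply/vlin_eq/coefs_eqW => i; ring.
- by rewrite IH -vlinZ.
Qed.

Lemma vexp_eq env t1 t2 :
  coefs_eq (size env) (vcoef t1) (vcoef t2) -> vden env t1 = vden env t2.
Proof. by move=> h; rewrite !vden_lin; apply: vlin_eq. Qed.
End Vec.

Ltac vmem x l :=
  lazymatch l with
  | nil => constr:(false)
  | x :: _ => constr:(true)
  | _ :: ?l' => vmem x l'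
  end.
Ltac vindex x l :=
  lazymatch l with
  | x :: _ => constr:(0%N)
  | _ :: ?l' => let i := vindex x l' in constr:(S i)
  end.
Ltac vatoms t l :=
  lazymatch t with
  | vadd ?x ?y => let l1 := vatoms x l in vatoms y l1
  | vopp ?x => vatoms x l
  | vscal _ ?x => vatoms x l
  | vzero _ => l
  | _ => let b := vmem t l in
         lazymatch b with true => l | false => constr:(t :: l) end
  end.
Ltac vreify t l :=
  lazymatch t with
  | vadd ?x ?y => let a := vreify x l in let b := vreify y l in constr:(VAdd a b)
  | vopp ?x => let a := vreify x l in constr:(VOpp a)
  | vscal ?c ?x => let a := vreify x l in constr:(VScal c a)
  | vzero _ => constr:(VZero)
  | _ => let i := vindex t l in constr:(VAtom i)
  end.
(* Decides linear identities in a complex vector space by comparing the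
   coefficient of each atom. *)
Ltac vec_eq :=
  lazymatch goal with
  | |- @eq ?T ?x ?y =>
    let l0 := constr:(@nil T) in
    let l1 := vatoms x l0 in let l := vatoms y l1 in
    let a := vreify x l in let b := vreify y l in
    apply: (@vexp_eq _ l a b);
    cbn [coefs_eq size vcoef Nat.eqb];
    repeat split; apply: Cx_eq => /=; try (by []); try ring; try (by field; lra)
  end.

(** * Separation of a point from a cone with order unit *)

Section Separation.
Variables (W : CVec) (C : W -> Prop) (u : W).
Notation "r *: x" := (vscal (RtoC r) x) (at level 40).
Notation "x +v y" := (vadd x y) (at level 50, left associativity).
Notation "x -v y" := (vadd x (vopp y)) (at level 50, left associativity).

Definition vcone (A : W -> Prop) : Prop :=
  (forall x y, A x -> A y -> A (x +v y)) /\ (forall t x, 0 <= t -> A x -> A (t *: x)).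

Hypothesis C_cone : vcone C.
Hypothesis C_unit : forall x, exists t, 0 < t /\ C (t *: u +v x).

Section TotalCone.
Variable A : W -> Prop.
Hypotheses (A_cone : vcone A) (subCA : forall x, C x -> A x) (AuN : ~ A (vopp u)).
Hypothesis A_total : forall x, A x \/ A (vopp x).

Let A_u : A u.
Proof.
have [t [t0 /subCA At]] := C_unit (vzero W).
have -> : u = (/ t) *: (t *: u +v vzero W) by vec_eq.
by apply: A_cone.2 => //; left; apply: Rinv_0_lt_compat.
Qed.

Let A_neg t : t < 0 -> ~ A (t *: u).
Proof.
move=> t0 At; apply: AuN.
have -> : vopp u = (/ - t) *: (t *: u) by vec_eq.
by apply: A_cone.2 => //; left; apply: Rinv_0_lt_compat; lra.
Qed.

(** The number [r] is the Dedekind cut of [x] against the multiples of [u] in the order given by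
    [A], and will be the value of the functional at [x]. The margin [d] is there because [A] need
    not be closed. *)
Definition cut x r := forall d, 0 < d -> A (x -v (r - d) *: u) /\ A ((r + d) *: u -v x).

Let cut_ex x : exists r, cut x r.
Proof.
have [t [t0 /subCA At]] := C_unit x; have [s [s0 /subCA As]] := C_unit (vopp x).
have bnd : bound (fun r => A (x -v r *: u)).
  exists s => r Ar; case: (Rle_lt_dec r s) => // rs.
  exfalso; apply: (@A_neg (s - r)); first lra.
  have -> : (s - r) *: u = (x -v r *: u) +v (s *: u +v vopp x) by vec_eq.
  exact: A_cone.1.
have ne : exists r, A (x -v r *: u).
  exists (- t); have -> // : x -v (- t) *: u = t *: u +v x by vec_eq.
have [r [rub rlub]] := completeness _ bnd ne.
exists r => d d0; split.
- have [y [Ay ry]] : exists y, A (x -v y *: u) /\ r - d < y.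
    apply: contrapT => h; suff : r <= r - d by lra.
    apply: rlub => y Ay; case: (Rle_lt_dec y (r - d)) => // hy.
    by case: h; exists y.
  have -> : x -v (r - d) *: u = (x -v y *: u) +v (y - (r - d)) *: u by vec_eq.
  by apply: A_cone.1 => //; apply: A_cone.2 => //; lra.
(* Beyond the supremum [r] the first alternative fails, so totality yields the upper half of the
   cut. *)
- case: (A_total (x -v (r + d) *: u)) => [/rub|]; first lra.
  by have -> // : vopp (x -v (r + d) *: u) = (r + d) *: u -v x by vec_eq.
Qed.

Let cut_ge0 x r : cut x r -> A x -> 0 <= r.
Proof.
move=> xr Ax; apply: Rnot_lt_le => r0; apply: (@A_neg (r / 2)); first lra.
have -> : (r / 2) *: u = ((r + - r / 2) *: u -v x) +v x by vec_eq.
by apply: A_cone.1 => //; apply: (xr _ _).2; lra.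
Qed.

Let cutD x y r s : cut x r -> cut y s -> cut (x +v y) (r + s).
Proof.
move=> xr ys d d0; have d2 : 0 < d / 2 by lra.
have [x1 x2] := xr _ d2; have [y1 y2] := ys _ d2; split.
- have -> : x +v y -v (r + s - d) *: u =
    (x -v (r - d / 2) *: u) +v (y -v (s - d / 2) *: u) by vec_eq.
  exact: A_cone.1.
- have -> : (r + s + d) *: u -v (x +v y) =
    ((r + d / 2) *: u -v x) +v ((s + d / 2) *: u -v y) by vec_eq.
  exact: A_cone.1.
Qed.

Let cutN x r : cut x r -> cut (vopp x) (- r).
Proof.
move=> xr d d0; have [x1 x2] := xr _ d0; split.
- by have -> : vopp x -v (- r - d) *: u = (r + d) *: u -v x by vec_eq.
- by have -> : (- r + d) *: u -v vopp x = x -v (r - d) *: u by vec_eq.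
Qed.

Let cut_le x r s : cut x r -> cut x s -> r <= s.
Proof.
(* Adding the two halves with margin [(r - s) / 3] each leaves a third of the gap, a negative
   multiple of [u] inside [A]. *)
move=> xr xs; apply: Rnot_lt_le => sr; apply: (@A_neg (- ((r - s) / 3))); first lra.
have d0 : 0 < (r - s) / 3 by lra.
have -> : (- ((r - s) / 3)) *: u =
  ((s + (r - s) / 3) *: u -v x) +v (x -v (r - (r - s) / 3) *: u) by vec_eq.
by apply: A_cone.1; [apply: (xs _ d0).2 | apply: (xr _ d0).1].
Qed.

Let cut_uniq x r s : cut x r -> cut x s -> r = s.
Proof. by move=> xr xs; apply: Rle_antisym; apply: (@cut_le x). Qed.

Let cutZ_pos t x r : 0 < t -> cut x r -> cut (t *: x) (t * r).
Proof.
move=> t0 xr d d0; have dt : 0 < d / t by apply: Rdiv_lt_0_compat.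
have [x1 x2] := xr _ dt; have t1 : 0 <= t by lra.
split.
- have -> : t *: x -v (t * r - d) *: u = t *: (x -v (r - d / t) *: u)
    by vec_eq.
  exact: A_cone.2.
- have -> : (t * r + d) *: u -v t *: x = t *: ((r + d / t) *: u -v x)
    by vec_eq.
  exact: A_cone.2.
Qed.

Let cut0 : cut (vzero W) 0.
Proof.
move=> d d0; split.
- have -> : vzero W -v (0 - d) *: u = d *: u by vec_eq.
  by apply: A_cone.2 => //; lra.
- have -> : (0 + d) *: u -v vzero W = d *: u by vec_eq.
  by apply: A_cone.2 => //; lra.
Qed.

Let cutZ t x r : cut x r -> cut (t *: x) (t * r).
Proof.
move=> xr; case: (Rtotal_order t 0) => [t0|[->|t0]]; last exact: cutZ_pos.
- have -> : t *: x = vopp ((- t) *: x) by vec_eq.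
  have -> : t * r = - (- t * r) by ring.
  by apply: cutN; apply: cutZ_pos => //; lra.
- by rewrite vscal0 Rmult_0_l; exact: cut0.
Qed.

Let cut_u : cut u 1.
Proof.
move=> d d0; split.
- have -> : u -v (1 - d) *: u = d *: u by vec_eq.
  by apply: A_cone.2 => //; lra.
- have -> : (1 + d) *: u -v u = d *: u by vec_eq.
  by apply: A_cone.2 => //; lra.
Qed.

(** In a total order with order unit every vector has exactly one cut, so nothing is left to choose,
    and linearity follows from uniqueness of cuts. *)
Lemma total_cone_functional : exists f : W -> R,
  [/\ forall x y, f (x +v y) = f x + f y, forall t x, f (t *: x) = t * f x,
      forall x, A x -> 0 <= f x & f u = 1].
Proof.
have [f fP] := choice cut_ex; exists f; split.
- by move=> x y; apply: cut_uniq (fP _) (cutD (fP x) (fP y)).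
- by move=> t x; apply: cut_uniq (fP _) (cutZ t (fP x)).
- by move=> x; apply: cut_ge0.
- exact: cut_uniq (fP _) cut_u.
Qed.
End TotalCone.

(** A cone maximal among those that avoid [- u] is total: if neither [x] nor [- x] belonged to it,
    adjoining either one would produce [- u], and a positive combination of the two expressions
    eliminates [x]. *)
Lemma total_cone_extension (D : W -> Prop) :
    vcone D -> (exists x, D x) -> ~ D (vopp u) -> exists A : W -> Prop,
  [/\ vcone A, forall x, D x -> A x, ~ A (vopp u) & forall x, A x \/ A (vopp x)].
Proof.
move=> D_cone [x0 Dx0] DuN.
(* The empty set is allowed so that the empty chain has an upper bound. *)
pose P (A : set W) := [/\ vcone A, ~ A (vopp u) & forall x, A x -> forall y, D y -> A y].
have [F FP Ftot|A [[A_cone AuN subDA] Amax]] := @Zorn_bigcup _ P.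
  split.
  - split=> [x y [X FX Xx] [Y FY Yy]|t x t0 [X FX Xx]].
    + case: (Ftot _ _ FX FY) => XY.
      * by exists Y => //; have [[+ _] _ _] := FP _ FY; apply=> //; apply: XY.
      * by exists X => //; have [[+ _] _ _] := FP _ FX; apply=> //; apply: XY.
    + by exists X => //; have [[_ +] _ _] := FP _ FX; apply.
  - by case=> X FX; have [_ + _] := FP _ FX.
  - move=> x [X FX Xx] y Dy; exists X => //.
    by have [_ _ +] := FP _ FX; apply; [exact: Xx|].
(* If some point of [D] were missing from [A], then [A] would be empty and [D] would contradict its
   maximality. *)
have {}subDA x : D x -> A x.
  move=> Dx; apply: contrapT => nAx.
  apply: (Amax D); last by split.
  split=> [|sDA]; last by apply/nAx/sDA.
  by move=> y Ay; case: nAx; apply: (subDA y).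
have A0 : A (vzero W) by rewrite -(vscal0 x0); apply: A_cone.2; [lra|exact: subDA].
(* By maximality the cone generated by [A] and [z] contains [- u]; the coefficient of [z] is nonzero
   since [A] itself avoids [- u]. *)
have ext z : ~ A z -> exists a s, [/\ A a, 0 < s & vopp u = a +v s *: z].
  move=> nAz; pose B : set W := fun y => exists a s, [/\ A a, 0 <= s & y = a +v s *: z].
  have AB y : A y -> B y by exists y, 0; split=> //; [lra|vec_eq].
  have : ~ P B.
    apply: Amax; split=> // BA; apply/nAz/BA.
    by exists (vzero W), 1; split=> //; [lra|vec_eq].
  move=> nPB; apply: contrapT => nex; apply: nPB; split; last by move=> *; apply/AB/subDA.
  - split=> [x y [a [s [Aa s0 ->]]] [b [t [Ab t0 ->]]]|t x t0 [a [s [Aa s0 ->]]]].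
    + exists (a +v b), (s + t); split; [exact: A_cone.1|lra|vec_eq].
    + exists (t *: a), (t * s); split; [exact: A_cone.2|exact: Rmult_le_pos|vec_eq].
  - case=> a [s [Aa s0 E]].
    case: s0 => [s0|s0]; first by apply: nex; exists a, s.
    by apply: AuN; rewrite E -s0 vscal0 vadd0.
exists A; split=> // x; case: (pselect (A x)) => [|nAx]; first by left.
right; apply: contrapT => nANx.
have [a [s [Aa s0 E1]]] := ext _ nAx; have [b [t [Ab t0 E2]]] := ext _ nANx.
(* The weights [t] and [s] make the multiples of [x] and [- x] cancel. *)
apply: AuN; have -> : vopp u = (/ (t + s)) *: (t *: vopp u +v s *: vopp u)
  by vec_eq.
apply: A_cone.2; first by left; apply: Rinv_0_lt_compat; lra.
rewrite {1}E1 E2.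
have -> : t *: (a +v s *: x) +v s *: (b +v t *: vopp x) = t *: a +v s *: b by vec_eq.
by apply: A_cone.1; apply: A_cone.2 => //; lra.
Qed.

(** The cone [D] generated by [C] and [- (t u + z)] avoids [- u], since otherwise [t u + z] would
    lie in [C]. A functional that is nonnegative on [D] with value 1 at [u] then gives
    [f z <= - t]. *)
Lemma cone_separation z t : 0 < t -> ~ C (t *: u +v z) -> exists f : W -> R,
  [/\ forall x y, f (x +v y) = f x + f y, forall s x, f (s *: x) = s * f x,
      forall x, C x -> 0 <= f x & f z < 0].
Proof.
move=> t0 nCz.
pose D x := exists c s, [/\ C c, 0 <= s & x = c -v s *: (t *: u +v z)].
have [t1 [t10 Ct1]] := C_unit (vzero W).
have Cu : C u.
  have -> : u = (/ t1) *: (t1 *: u +v vzero W) by vec_eq.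
  by apply: C_cone.2 => //; left; apply: Rinv_0_lt_compat.
have C0' : C (vzero W) by rewrite -(vscal0 u); apply: C_cone.2 => //; lra.
have D_cone : vcone D.
  split=> [x y [a [s [Aa s0 ->]]] [b [r [Ab r0 ->]]]|r x r0 [a [s [Aa s0 ->]]]].
  + exists (a +v b), (s + r); split; [exact: C_cone.1|lra|vec_eq].
  + exists (r *: a), (r * s); split; [exact: C_cone.2|exact: Rmult_le_pos|vec_eq].
have CD x : C x -> D x by move=> Cx; exists x, 0; split=> //; [lra|vec_eq].
have DuN : ~ D (vopp u).
  case=> c [s [Cc s0 E]]; apply: nCz; case: s0 => [s0|s0].
    have -> : t *: u +v z = (/ s) *: (c -v vopp u) by rewrite E; vec_eq.
    apply: C_cone.2; first by left; apply: Rinv_0_lt_compat.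
    have -> : c -v vopp u = c +v u by vec_eq.
    exact: C_cone.1.
  (* With [s = 0] the cone [C] contains [- u], and the order unit property then makes it the whole
     space. *)
  have CuN : C (vopp u) by have -> : vopp u = c by rewrite E -s0; vec_eq.
  have [r [r0 Cr]] := C_unit (t *: u +v z).
  have -> : t *: u +v z = (r *: u +v (t *: u +v z)) +v r *: vopp u by vec_eq.
  by apply: C_cone.1 => //; apply: C_cone.2 => //; lra.
have [|A [A_cone subDA AuN A_total]] := total_cone_extension D_cone _ DuN.
  by exists u; apply: CD.
have subCA x : C x -> A x by move=> /CD /subDA.
have [f [fD fZ fpos fu]] := total_cone_functional A_cone subCA AuN A_total.
exists f; split=> // [x /subCA /fpos //|].
have : 0 <= f (vopp (t *: u +v z)).
  apply/fpos/subDA; exists (vzero W), 1; split=> //; [lra|vec_eq].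
have -> : vopp (t *: u +v z) = (- t) *: u +v (- 1) *: z by vec_eq.
by rewrite fD !fZ fu; lra.
Qed.
End Separation.

(** * Inner products and the norm as an accretivity condition *)

Lemma cre_sum I (r : seq I) (F : I -> Cx) :
  cre (\big[Cplus/C0]_(i <- r) F i) = \sumR_(i <- r) cre (F i).
Proof. exact: big_morph. Qed.

Lemma sumR_ge0 I (r : seq I) (F : I -> R) :
  (forall i, 0 <= F i) -> 0 <= \sumR_(i <- r) F i.
Proof. by move=> h; elim/big_ind: _ => // *; lra. Qed.

Lemma sumR_le I (r : seq I) (F G : I -> R) :
  (forall i, F i <= G i) -> \sumR_(i <- r) F i <= \sumR_(i <- r) G i.
Proof. by move=> h; elim/big_ind2: _ => // *; lra. Qed.

Lemma sumR_opp I (r : seq I) (F : I -> R) :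
  \sumR_(i <- r) - F i = - \sumR_(i <- r) F i.
Proof. by symmetry; apply: big_morph => [x y|]; ring. Qed.

Section Inner.
Variable H : Hilb.
Implicit Types x y z : H.
Definition nrm2 x : R := cre (hinner x x).

Lemma nrm2_ge0 x : 0 <= nrm2 x. Proof. exact: hinner_ge0. Qed.

Lemma hinnerDr x y z : hinner x (vadd y z) = Cplus (hinner x y) (hinner x z).
Proof.
by rewrite hinnerC hinnerD (hinnerC x y) (hinnerC x z); apply: Cx_eq => /=; ring.
Qed.

Lemma hinnerZr a x y : hinner x (vscal a y) = Cmult (Cconj a) (hinner x y).
Proof. by rewrite hinnerC hinnerZ (hinnerC x y); apply: Cx_eq => /=; ring. Qed.

Lemma hinner0l y : hinner (vzero H) y = C0.
Proof. by rewrite -(vscal0 (vzero H)) hinnerZ; ring. Qed.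

Lemma hinner_suml n (F : 'I_n -> H) y :
  hinner (\sumV_(i < n) F i) y = \sumC_(i < n) hinner (F i) y.
Proof. by elim/big_rec2: _ => [|i a b _ <-]; rewrite ?hinnerD ?hinner0l. Qed.

Lemma cre_hinnerC x y : cre (hinner y x) = cre (hinner x y).
Proof. by rewrite hinnerC. Qed.

Lemma nrm2_scale_sub s x y :
  nrm2 (vadd (vscal (RtoC s) x) (vopp y)) =
  s * s * nrm2 x - 2 * s * cre (hinner y x) + nrm2 y.
Proof.
rewrite /nrm2 voppE !(hinnerD, hinnerDr, hinnerZ, hinnerZr) /=.
rewrite (cre_hinnerC y x) (hinnerC y x) /=; ring.
Qed.

Lemma nrm2Z a x : nrm2 (vscal a x) = (cre a * cre a + cim a * cim a) * nrm2 x.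
Proof. by rewrite /nrm2 hinnerZ hinnerZr /=; ring. Qed.

Lemma nrm2D x y : nrm2 (vadd x y) = nrm2 x + nrm2 y + 2 * cre (hinner x y).
Proof. by rewrite /nrm2 !(hinnerD, hinnerDr) /= (cre_hinnerC y x); ring. Qed.

Lemma nrm2D_le x y : nrm2 (vadd x y) <= 2 * nrm2 x + 2 * nrm2 y.
Proof.
have := nrm2_ge0 (vadd (vscal (RtoC 1) x) (vopp y)).
by rewrite nrm2_scale_sub nrm2D cre_hinnerC; lra.
Qed.

Lemma nrm2_0 : nrm2 (vzero H) = 0. Proof. by rewrite /nrm2 hinner0l. Qed.

Lemma nrm2_eq0 x : nrm2 x = 0 -> x = vzero H.
Proof.
move=> h; apply: hinner_eq0; apply: Cx_eq => //=.
by have /(congr1 cim) /= := hinnerC x x; lra.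
Qed.

Lemma normsq_ge0 n (x : 'I_n -> H) : 0 <= normsq_n x.
Proof. by apply: sumR_ge0 => i; exact: hinner_ge0. Qed.

Lemma normsqZ n s (x : 'I_n -> H) :
  normsq_n (fun i => vscal (RtoC s) (x i)) = s * s * normsq_n x.
Proof.
rewrite /normsq_n big_distrr /=; apply: eq_bigr => i _.
by have := nrm2Z (RtoC s) (x i); rewrite /nrm2 /= => ->; ring.
Qed.

(** The double sum matches the positivity condition on forms and can be summed over the components
    of a direct sum entry by entry. *)
Definition quad n (T : 'I_n -> 'I_n -> H -> H) (x : 'I_n -> H) : R :=
  \sumR_(i < n) \sumR_(j < n) cre (hinner (T i j (x j)) (x i)).

Lemma op_accretiveE n (T : 'I_n -> 'I_n -> H -> H) :
  op_accretive T <-> forall x : 'I_n -> H, 0 <= quad T x.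
Proof.
suff E (x : 'I_n -> H) : quad T x = \sumR_(i < n) cre (hinner (opapp T x i) (x i)).
  by split=> h x; have := h x; rewrite E.
by apply: eq_bigr => i _; rewrite /opapp hinner_suml cre_sum.
Qed.
End Inner.

(** * Unital positive representations and the norm of a block matrix *)

Section Rep.
Variables (Z : CVec) (K : forall n, mat Z n -> Prop) (e : Z).

(** Boundedness is not part of the definition: it follows from positivity on 2-by-2 blocks and the
    order unit. *)
Definition unital_positive (H : Hilb) (T : Z -> H -> H) : Prop :=
  [/\ clinear T,
      forall z, (forall x y, T z (vadd x y) = vadd (T z x) (T z y)) /\
                (forall a x, T z (vscal a x) = vscal a (T z x)),
      forall h, T e h = h &
      forall n, (0 < n)%N -> forall A : mat Z n, K A -> op_accretive (ampl T A)].

Variables (H : Hilb) (T : Z -> H -> H).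
Hypothesis T_rep : unital_positive T.

Lemma rep_vzero h : T (vzero Z) h = vzero H.
Proof. by have [[_ h1] _ _ _] := T_rep; rewrite -(vscal0 (vzero Z)) h1 vscal0. Qed.

Lemma rep_vopp z h : T (vopp z) h = vopp (T z h).
Proof. by have [[_ h1] _ _ _] := T_rep; rewrite !voppE h1. Qed.

Lemma opappZ n (z : mat Z n) a (x : 'I_n -> H) i :
  opapp (ampl T z) (fun j => vscal a (x j)) i = vscal a (opapp (ampl T z) x i).
Proof.
have [_ h _ _] := T_rep; rewrite /opapp /ampl.
elim/big_rec2: _ => [|j u v _ ->]; first by rewrite vscalx0.
by rewrite (h _).2 vscalDr.
Qed.

(** The 2 in [block2] makes the cross term that of a square: [t] times the right-hand side is
    [|t a - T b|^2 + t^2 |b|^2 - |T b|^2]. *)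
Lemma quad_block n (z : mat Z n) t (x : 'I_(n + n) -> H) :
  let a i := x (lshift n i) in let b i := x (rshift n i) in
  quad (ampl T (madd (mscal (RtoC t) (eI e (n + n)%N)) (mopp (block2 z)))) x =
  t * normsq_n a + t * normsq_n b
  - 2 * \sumR_(i < n) cre (hinner (opapp (ampl T z) b i) (a i)).
Proof.
move=> a b; have [[TD TZ] _ Te _] := T_rep.
(* [Q1] collects the diagonal part coming from [t e], and [Q2] the block part, which survives only
   for a row in the first half and a column in the second. *)
pose Q1 i j := t * (if i == j then cre (hinner (x j) (x i)) else 0).
pose Q2 i j := cre (hinner (T (block2 z i j) (x j)) (x i)).
transitivity (\sumR_(i < n + n) (\sumR_(j < n + n) Q1 i j + - \sumR_(j < n + n) Q2 i j)).
  apply: eq_bigr => i _; rewrite -sumR_opp -big_split /=; apply: eq_bigr => j _.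
  rewrite /ampl /madd /mscal /mopp TD TZ rep_vopp voppE hinnerD !hinnerZ /Q1 /Q2 /eI.
  by case: (i == j); rewrite ?Te ?rep_vzero ?hinner0l /=; ring.
rewrite big_split /= sumR_opp /Rminus; congr (_ + - _).
  rewrite -Rmult_plus_distr_l.
  have -> : normsq_n a + normsq_n b = normsq_n x by rewrite {3}/normsq_n big_split_ord.
  rewrite /normsq_n big_distrr /=.
  apply: eq_bigr => i _.
  have E j : Q1 i j = if j == i then t * cre (hinner (x j) (x i)) else 0.
    by rewrite /Q1 eq_sym; case: (j == i) => //; ring.
  by rewrite (eq_bigr _ (fun j _ => E j)) -big_mkcond big_pred1_eq.
rewrite big_split_ord /= [X in _ + X]big1 ?Rplus_0_r => [|i _]; last first.
  apply: big1 => j _; rewrite /Q2 /block2 (unsplitK (inr i)).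
  by rewrite rep_vzero hinner0l.
rewrite big_distrr /=; apply: eq_bigr => i _.
rewrite big_split_ord /= [X in X + _]big1 ?Rplus_0_l => [|j _]; last first.
  by rewrite /Q2 /block2 (unsplitK (inl i)) (unsplitK (inl j)) rep_vzero hinner0l.
rewrite /opapp hinner_suml cre_sum big_distrr /=; apply: eq_bigr => j _.
rewrite /Q2 /block2 (unsplitK (inl i)) (unsplitK (inr j)) TZ hinnerZ /ampl /=.
by rewrite /b /a; ring.
Qed.

(* The off-diagonal test vector [(T b / t, b)] turns accretivity into a norm bound. *)
Lemma rep_norm_le n (z : mat Z n) t : (0 < n)%N -> unit_norm_set K e z t ->
  forall b : 'I_n -> H, normsq_n (opapp (ampl T z) b) <= t * t * normsq_n b.
Proof.
move=> n0 [t0 Kz] b; have [_ _ _ Tpos] := T_rep.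
have nn0 : (0 < n + n)%N by rewrite addn_gt0 n0.
set c := opapp (ampl T z) b.
pose x i := match split i with inl j => vscal (RtoC (/ t)) (c j) | inr j => b j end.
have /op_accretiveE /(_ x) := Tpos _ nn0 _ Kz.
rewrite quad_block.
have -> : (fun i => x (rshift n i)) = b.
  by apply: funext => i; rewrite /x (unsplitK (inr i)).
have -> : (fun i => x (lshift n i)) = (fun j => vscal (RtoC (/ t)) (c j)).
  by apply: funext => i; rewrite /x (unsplitK (inl i)).
rewrite normsqZ -/c.
have -> : \sumR_(i < n) cre (hinner (c i) (x (lshift n i))) = / t * normsq_n c.
  rewrite /normsq_n big_distrr /=; apply: eq_bigr => i _.
  by rewrite /x (unsplitK (inl i)) hinnerZr /=; ring.
move=> h; have := Rmult_le_pos _ _ (Rlt_le _ _ t0) h.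
suff -> : t * (t * (/ t * / t * normsq_n c) + t * normsq_n b - 2 * (/ t * normsq_n c)) =
  t * t * normsq_n b - normsq_n c by lra.
by field; lra.
Qed.

(** Complete the square: after multiplication by [t], the quadratic form is [|t a - T b|^2] plus the
    nonnegative defect [t^2 |b|^2 - |T b|^2]. *)
Lemma rep_norm_accretive n (z : mat Z n) t : 0 < t ->
  (forall b : 'I_n -> H, normsq_n (opapp (ampl T z) b) <= t * t * normsq_n b) ->
  op_accretive (ampl T (madd (mscal (RtoC t) (eI e (n + n)%N)) (mopp (block2 z)))).
Proof.
move=> t0 h; apply/op_accretiveE => x; rewrite quad_block.
set a := fun i => x (lshift n i); set b := fun i => x (rshift n i).
set S := \sumR_(i < n) _.
have : 0 <= normsq_n (fun i => vadd (vscal (RtoC t) (a i)) (vopp (opapp (ampl T z) b i))).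
  exact: normsq_ge0.
have -> : normsq_n (fun i => vadd (vscal (RtoC t) (a i)) (vopp (opapp (ampl T z) b i))) =
   t * t * normsq_n a - 2 * t * S + normsq_n (opapp (ampl T z) b).
  rewrite /normsq_n /S !big_distrr /= /Rminus -sumR_opp -!big_split /=.
  by apply: eq_bigr => i _; have := nrm2_scale_sub t (a i) (opapp (ampl T z) b i).
move: (h b) => hb hq; apply: (Rmult_le_reg_l t) => //; nra.
Qed.
End Rep.

(** * Unordered sums *)

Section HasSum.
Variable J : choiceType.
Implicit Types (g h : J -> R) (s t : R) (F G : seq J).

(** Convergence along the finite subsets of [J], encoded as duplicate-free lists; no enumeration of
    [J] is needed. *)
Definition has_sum g s : Prop := forall d, 0 < d -> exists F0, uniq F0 /\
  forall F, uniq F -> {subset F0 <= F} -> Rabs (\sumR_(j <- F) g j - s) < d.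

Definition summable g : Prop := exists s, has_sum g s.

Definition sumJ g : R := if pselect (summable g) is left h then projT1 (cid h) else 0.

Lemma has_sum_uniq g s t : has_sum g s -> has_sum g t -> s = t.
Proof.
move=> hs ht; apply: contrapT => st.
have d0 : 0 < Rabs (s - t) / 2 by have := Rabs_pos_lt (s - t); lra.
have [F [_ hF]] := hs _ d0; have [G [_ hG]] := ht _ d0.
have {}hF := hF _ (undup_uniq (F ++ G)); have {}hG := hG _ (undup_uniq (F ++ G)).
have h1 : {subset F <= undup (F ++ G)} by move=> x xF; rewrite mem_undup mem_cat xF.
have h2 : {subset G <= undup (F ++ G)} by move=> x xF; rewrite mem_undup mem_cat xF orbT.
move: (hF h1) (hG h2); set S := \sumR_(j <- _) _; split_Rabs; lra.
Qed.

Lemma sumJE g s : has_sum g s -> sumJ g = s.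
Proof.
rewrite /sumJ => h; case: pselect => [h'|[]]; last by exists s.
by case: (cid h') => t /= /has_sum_uniq; apply.
Qed.

Lemma summableP g : summable g -> has_sum g (sumJ g).
Proof. by case=> s h; rewrite (sumJE h). Qed.

Lemma has_sumD g h s t :
  has_sum g s -> has_sum h t -> has_sum (fun j => g j + h j) (s + t).
Proof.
move=> hs ht d d0; have d2 : 0 < d / 2 by lra.
have [F [uF hF]] := hs _ d2; have [G [uG hG]] := ht _ d2.
exists (undup (F ++ G)); split=> [|X uX FGX]; first exact: undup_uniq.
have h1 : {subset F <= X} by move=> x xF; apply: FGX; rewrite mem_undup mem_cat xF.
have h2 : {subset G <= X} by move=> x xG; apply: FGX; rewrite mem_undup mem_cat xG orbT.
by rewrite big_split /=; move: (hF _ uX h1) (hG _ uX h2); split_Rabs; lra.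
Qed.

Lemma has_sumZ a g s : has_sum g s -> has_sum (fun j => a * g j) (a * s).
Proof.
move=> hs d d0; have a0 : 0 < Rabs a + 1 by have := Rabs_pos a; lra.
have [F [uF hF]] := hs (d / (Rabs a + 1)) (Rdiv_lt_0_compat _ _ d0 a0).
exists F; split=> // X uX FX; have {hF} := hF _ uX FX; set S := \sumR_(j <- _) _ => hF.
rewrite -big_distrr /= -/S -Rmult_minus_distr_l Rabs_mult.
apply: (@Rle_lt_trans _ ((Rabs a + 1) * Rabs (S - s))).
  by have := Rabs_pos (S - s); nra.
have -> : d = (Rabs a + 1) * (d / (Rabs a + 1)) by field; lra.
exact: Rmult_lt_compat_l.
Qed.

Lemma has_sum0 : has_sum (fun _ => 0) 0.
Proof.
by move=> d d0; exists [::]; split=> // F _ _; rewrite big1 // Rminus_0_r Rabs_R0.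
Qed.

Lemma has_sum_big n (g : 'I_n -> J -> R) (s : 'I_n -> R) :
  (forall i, has_sum (g i) (s i)) ->
  has_sum (fun j => \sumR_(i < n) g i j) (\sumR_(i < n) s i).
Proof.
move=> h; elim: (index_enum _) => [|i l IH].
  rewrite big_nil; have -> : (fun j => \sumR_(i <- [::]) g i j) = fun=> 0.
    by apply: funext => j; rewrite big_nil.
  exact: has_sum0.
rewrite big_cons.
have -> : (fun j => \sumR_(i <- i :: l) g i j) = fun j => g i j + \sumR_(i <- l) g i j.
  by apply: funext => j; rewrite big_cons.
exact: has_sumD.
Qed.

Lemma sum_subset g F G : (forall j, 0 <= g j) -> uniq F -> uniq G -> {subset F <= G} ->
  \sumR_(j <- F) g j <= \sumR_(j <- G) g j.
Proof.
move=> g0 uF uG FG; rewrite [X in _ <= X](bigID (fun j => j \in F)) /=.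
have -> : \big[Rplus/0]_(j <- G | j \in F) g j = \sumR_(j <- F) g j.
  rewrite -big_filter; apply: perm_big; apply: uniq_perm => //; first exact: filter_uniq.
  by move=> j; rewrite mem_filter; case jF: (j \in F) => //=; rewrite FG.
rewrite -[X in X <= _]Rplus_0_r; apply: Rplus_le_compat_l.
by rewrite -big_filter; apply: sumR_ge0.
Qed.

Lemma has_sum_fin_le g s F : (forall j, 0 <= g j) -> has_sum g s -> uniq F ->
  \sumR_(j <- F) g j <= s.
Proof.
move=> g0 hs uF; apply: Rnot_lt_le => lt.
have [|G [uG hG]] := hs (\sumR_(j <- F) g j - s); first lra.
have h1 : {subset G <= undup (F ++ G)} by move=> x xF; rewrite mem_undup mem_cat xF orbT.
have h2 : {subset F <= undup (F ++ G)} by move=> x xF; rewrite mem_undup mem_cat xF.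
move: (hG _ (undup_uniq _) h1) (sum_subset g0 uF (undup_uniq _) h2).
by set S := \sumR_(j <- undup _) _; split_Rabs; lra.
Qed.

Lemma has_sum_ge0 g s : (forall j, 0 <= g j) -> has_sum g s -> 0 <= s.
Proof.
by move=> g0 /(@has_sum_fin_le g s [::] g0) /(_ erefl); rewrite big_nil.
Qed.

(** For nonnegative terms the sum is the supremum of the finite partial sums. *)
Lemma has_sum_bounded g M : (forall j, 0 <= g j) ->
  (forall F, uniq F -> \sumR_(j <- F) g j <= M) -> exists s, has_sum g s /\ s <= M.
Proof.
move=> g0 hM; pose E r := exists F, uniq F /\ r = \sumR_(j <- F) g j.
have [||s [sub slub]] := completeness E.
- by exists M => _ [F [uF ->]]; apply: hM.
- by exists 0, [::]; rewrite big_nil.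
exists s; split; last by apply: slub => _ [F [uF ->]]; apply: hM.
move=> d d0; have [F [uF hF]] : exists F, uniq F /\ s - d < \sumR_(j <- F) g j.
  apply: contrapT => h; suff : s <= s - d by lra.
  apply: slub => _ [F [uF ->]]; apply: Rnot_lt_le => lt.
  by case: h; exists F.
exists F; split=> // G uG FG.
have := sum_subset g0 uF uG FG.
have := sub _ (ex_intro _ G (conj uG erefl)).
by split_Rabs; lra.
Qed.

Lemma summable_le g h : (forall j, 0 <= g j <= h j) -> summable h -> summable g.
Proof.
move=> gh [s hs]; have h0 j : 0 <= h j by have := gh j; lra.
have [|F uF|t [ht _]] := @has_sum_bounded g s; first by move=> j; have := gh j; lra.
  apply: Rle_trans (has_sum_fin_le h0 hs uF).
  by apply: sumR_le => j; have := gh j; lra.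
by exists t.
Qed.

Lemma has_sum_single g j0 : (forall j, j != j0 -> g j = 0) -> has_sum g (g j0).
Proof.
move=> h d d0; exists [:: j0]; split=> // F uF jF.
have {}jF : j0 \in F by apply: jF; rewrite inE.
rewrite (bigD1_seq j0) //= [X in _ + X]big1 //.
by rewrite Rplus_0_r Rminus_diag Rabs_R0.
Qed.
End HasSum.

(** The maximum of finitely many thresholds works for all of [F] at once. Both completeness proofs
    use this to pass from coordinatewise limits to norms. *)
Lemma eventually_sum_le I (F : seq I) (a : I -> nat -> R) :
  (forall i d, 0 < d -> exists N, forall m, (N <= m)%nat -> a i m < d) ->
  forall d, 0 < d -> exists N, forall m, (N <= m)%nat -> \sumR_(i <- F) a i m < d.
Proof.
move=> h; elim: F => [|i F IH] d d0; first by exists 0%N => m _; rewrite big_nil.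
have [|N1 h1] := h i (d / 2); first lra.
have [|N2 h2] := IH (d / 2); first lra.
exists (maxn N1 N2) => m; rewrite geq_max => /andP[/h1 ? /h2 ?].
by rewrite big_cons; lra.
Qed.

(** * Hilbert direct sums *)

Section DirectSum.
Variables (J : choiceType) (E : J -> Hilb).

Definition sq_summable (x : forall j, E j) : Prop := summable (fun j => nrm2 (x j)).

Definition dsum : Type := {x : forall j, E j | sq_summable x}.

Lemma dsum_eq (x y : dsum) : (forall j, sval x j = sval y j) -> x = y.
Proof.
by case: x y => [x hx] [y hy] /= h; apply: eq_exist; apply: functional_extensionality_dep.
Qed.

Lemma sq_summableD x y : sq_summable x -> sq_summable y ->
  sq_summable (fun j => vadd (x j) (y j)).
Proof.
move=> [s hs] [t ht]; apply: summable_le (ex_intro _ _ (has_sumD (has_sumZ 2 hs) (has_sumZ 2 ht))).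
by move=> j; split; [exact: nrm2_ge0 | exact: nrm2D_le].
Qed.

Lemma sq_summableZ a x : sq_summable x -> sq_summable (fun j => vscal a (x j)).
Proof.
move=> [s /(has_sumZ (cre a * cre a + cim a * cim a)) hs]; eexists.
by under eq_fun do rewrite nrm2Z; exact: hs.
Qed.

Lemma sq_summable0 : sq_summable (fun j => vzero (E j)).
Proof. by exists 0; under eq_fun do rewrite nrm2_0; exact: has_sum0. Qed.

Definition dsum_add (x y : dsum) : dsum := exist _ _ (sq_summableD (svalP x) (svalP y)).
Definition dsum_scal a (x : dsum) : dsum := exist _ _ (sq_summableZ a (svalP x)).
Definition dsum_zero : dsum := exist _ _ sq_summable0.

Definition dsum_vec : CVec.
Proof.
refine (@Build_CVec dsum dsum_add dsum_zero (dsum_scal (Copp C1)) dsum_scal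
  _ _ _ _ _ _ _ _); move=> *; apply: dsum_eq => j /=.
- exact: vaddA.
- exact: vaddC.
- exact: vadd0.
- by rewrite -voppE vaddN.
- exact: vscal1.
- exact: vscalA.
- exact: vscalDr.
- exact: vscalDl.
Defined.

(** Polarization writes the real part through [|x + y|^2], [|x|^2] and [|y|^2], all summable, so
    Cauchy-Schwarz is avoided. The imaginary part is the real part for [- i x]. *)
Lemma summable_re (x y : dsum) : summable (fun j => cre (hinner (sval x j) (sval y j))).
Proof.
have [s hs] := svalP x; have [t ht] := svalP y.
have [r hr] := sq_summableD (svalP x) (svalP y).
exists (/ 2 * (r + -1 * (s + t))).
have := has_sumZ (/ 2) (has_sumD hr (has_sumZ (-1) (has_sumD hs ht))).
congr has_sum; apply: funext => j; rewrite nrm2D; lra.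
Qed.

Lemma summable_im (x y : dsum) : summable (fun j => cim (hinner (sval x j) (sval y j))).
Proof.
have [s hs] := summable_re (dsum_scal (Copp Ci) x) y; exists s.
by move: hs; congr has_sum; apply: funext => j /=; rewrite hinnerZ /=; ring.
Qed.

Definition dsum_inner (x y : dsum) : Cx :=
  mkC (sumJ (fun j => cre (hinner (sval x j) (sval y j))))
      (sumJ (fun j => cim (hinner (sval x j) (sval y j)))).

Lemma dsum_nrm2 (x : dsum) :
  has_sum (fun j => nrm2 (sval x j)) (cre (dsum_inner x x)).
Proof. exact: summableP (summable_re x x). Qed.

Lemma dsum_nrm2_ge0 (x : dsum) : 0 <= cre (dsum_inner x x).
Proof. by apply: has_sum_ge0 (dsum_nrm2 x) => j; exact: nrm2_ge0. Qed.

Lemma dsum_coord_le (x : dsum) j : nrm2 (sval x j) <= cre (dsum_inner x x).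
Proof.
have := @has_sum_fin_le _ _ _ [:: j] (fun j => nrm2_ge0 (sval x j)) (dsum_nrm2 x) erefl.
by rewrite big_seq1.
Qed.

Lemma dsum_innerD x y z :
  dsum_inner (dsum_add x y) z = Cplus (dsum_inner x z) (dsum_inner y z).
Proof.
apply: Cx_eq => /=; apply: sumJE.
  have := has_sumD (summableP (summable_re x z)) (summableP (summable_re y z)).
  by congr has_sum; apply: funext => j; rewrite hinnerD.
have := has_sumD (summableP (summable_im x z)) (summableP (summable_im y z)).
by congr has_sum; apply: funext => j; rewrite hinnerD.
Qed.

Lemma dsum_innerZ a x y : dsum_inner (dsum_scal a x) y = Cmult a (dsum_inner x y).
Proof.
have hr := summableP (summable_re x y); have hi := summableP (summable_im x y).
apply: Cx_eq => /=; apply: sumJE.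
  have := has_sumD (has_sumZ (cre a) hr) (has_sumZ (- cim a) hi).
  have -> : forall u v, cre a * u + - cim a * v = cre a * u - cim a * v by move=> *; ring.
  by congr has_sum; apply: funext => j; rewrite hinnerZ /=; ring.
have := has_sumD (has_sumZ (cre a) hi) (has_sumZ (cim a) hr).
by congr has_sum; apply: funext => j; rewrite hinnerZ /=.
Qed.

Lemma dsum_innerC x y : dsum_inner y x = Cconj (dsum_inner x y).
Proof.
apply: Cx_eq => /=; apply: sumJE.
  have := summableP (summable_re x y).
  by congr has_sum; apply: funext => j; rewrite (hinnerC (sval x j)).
have := has_sumZ (-1) (summableP (summable_im x y)).
have -> : forall u, -1 * u = - u by move=> *; ring.
by congr has_sum; apply: funext => j; rewrite (hinnerC (sval x j)) /=; ring.
Qed.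

Lemma dsum_inner_eq0 x : dsum_inner x x = C0 -> x = dsum_zero.
Proof.
move=> h; apply: dsum_eq => j; apply: nrm2_eq0; apply: Rle_antisym; last exact: nrm2_ge0.
by have := dsum_coord_le x j; rewrite h.
Qed.

Lemma sqrt_lt_sq x d : 0 < d -> sqrt x < d <-> x < d * d.
Proof.
move=> d0; split=> h; last first.
  rewrite -(sqrt_square d); last lra.
  case: (Rle_lt_dec 0 x) => x0; first exact: sqrt_lt_1_alt.
  by rewrite (sqrt_neg_0 x) ?sqrt_square; lra.
case: (Rle_lt_dec 0 x) => x0; last by nra.
by have := sqrt_sqrt _ x0; have := sqrt_pos x; nra.
Qed.

Lemma dsum_complete (u : nat -> dsum_vec) :
  (forall d, 0 < d -> exists N, forall m k, (N <= m)%nat -> (N <= k)%nat ->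
    let w := vadd (u m) (vopp (u k)) in sqrt (cre (dsum_inner w w)) < d) ->
  exists l : dsum_vec, forall d, 0 < d -> exists N, forall m, (N <= m)%nat ->
    let w := vadd (u m) (vopp l) in sqrt (cre (dsum_inner w w)) < d.
Proof.
move=> cau.
have cau2 d : 0 < d -> exists N, forall m k, (N <= m)%nat -> (N <= k)%nat ->
    cre (dsum_inner (vadd (u m) (vopp (u k))) (vadd (u m) (vopp (u k)))) < d.
  move=> d0; have sd := sqrt_lt_R0 _ d0; have [N h] := cau _ sd.
  exists N => m k Nm Nk; have := h m k Nm Nk => /=.
  by rewrite sqrt_lt_sq // sqrt_sqrt //; lra.
have lim j : exists l : E j, forall d, 0 < d -> exists N, forall m, (N <= m)%nat ->
    nrm2 (vadd (sval (u m) j) (vopp l)) < d.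
  have [d d0|l hl] := @hcomplete (E j) (fun m => sval (u m) j).
    have [N h] := cau d d0; exists N => m k Nm Nk; apply: Rle_lt_trans (h m k Nm Nk).
    apply: sqrt_le_1_alt; have := dsum_coord_le (vadd (u m) (vopp (u k))) j.
    by rewrite /= -voppE.
  exists l => d d0; have sd := sqrt_lt_R0 _ d0; have [N h] := hl _ sd.
  by exists N => m Nm; have := h m Nm; rewrite sqrt_lt_sq // sqrt_sqrt //; lra.
have [l hl] : exists l : forall j, E j, forall j d, 0 < d -> exists N, forall m, (N <= m)%nat ->
    nrm2 (vadd (sval (u m) j) (vopp (l j))) < d.
  by exists (fun j => projT1 (cid (lim j))) => j; exact: projT2 (cid (lim j)).
(* The threshold [N] must not depend on [F]. Compare [u m] with [u k] by the Cauchy property, and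
   [u k] with [l] on [F] only, where [k] may depend on [F]; the two errors [d / 4] are doubled by
   [nrm2D_le]. *)
have tail d : 0 < d -> exists N, forall m, (N <= m)%nat -> forall F, uniq F ->
    \sumR_(j <- F) nrm2 (vadd (sval (u m) j) (vopp (l j))) <= d.
  move=> d0; have d4 : 0 < d / 4 by lra.
  have [N hN] := cau2 _ d4; exists N => m Nm F uF.
  have [N' hN'] := @eventually_sum_le _ F _ hl _ d4.
  pose k := maxn N N'; have Nk : (N <= k)%nat by exact: leq_maxl.
  have {hN'} hk := hN' k (leq_maxr _ _).
  set w := vadd (u m) (vopp (u k)).
  have hw : \sumR_(j <- F) nrm2 (sval w j) <= cre (dsum_inner w w).
    by apply: has_sum_fin_le (dsum_nrm2 w) _ => // j; exact: nrm2_ge0.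
  have hm := hN m k Nm Nk; rewrite -/w in hm.
  apply: (@Rle_trans _ (2 * (\sumR_(j <- F) nrm2 (sval w j)) +
    2 * (\sumR_(j <- F) nrm2 (vadd (sval (u k) j) (vopp (l j)))))); last lra.
  rewrite !big_distrr -big_split /=; apply: sumR_le => j.
  apply: Rle_trans (nrm2D_le _ _); right; congr nrm2.
  by vec_eq.
have [N0 h0] := tail _ Rlt_0_1.
(* [l] is the difference of [u N0] and the square-summable family [u N0 - l]. *)
have sl : sq_summable l.
  have [s [hs _]] := has_sum_bounded (fun j => nrm2_ge0 _) (h0 N0 (leqnn _)).
  have hw : sq_summable (fun j => vadd (sval (u N0) j) (vopp (l j))) by exists s.
  have := sq_summableD (svalP (u N0)) (sq_summableZ (Copp C1) hw).
  by congr sq_summable; apply: functional_extensionality_dep => j; vec_eq.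
exists (exist _ l sl) => d d0 /=.
have [|N hN] := tail (d * d / 2); first by nra.
exists N => m Nm; rewrite sqrt_lt_sq //.
have hm := hN m Nm.
have [s [hs sd]] := has_sum_bounded (fun j => nrm2_ge0 _) hm.
set v := sumJ _; have -> : v = s; last nra.
apply: sumJE; move: hs; congr has_sum; apply: funext => j /=.
by rewrite -voppE.
Qed.

Definition dsum_hilb : Hilb :=
  @Build_Hilb dsum_vec dsum_inner dsum_innerD dsum_innerZ dsum_innerC dsum_nrm2_ge0
    dsum_inner_eq0 dsum_complete.

Lemma dsum_inj_ex j0 (x : E j0) : exists y : dsum_hilb,
  sval y j0 = x /\ forall j, j != j0 -> sval y j = vzero (E j).
Proof.
pose y := dfwith (fun j => vzero (E j)) x.
have y0 j : j != j0 -> y j = vzero (E j) by move=> jj; rewrite /y dfwith_out // eq_sym.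
have sy : sq_summable y.
  by exists (nrm2 (y j0)); apply: has_sum_single => j /y0 ->; rewrite nrm2_0.
by exists (exist _ y sy); split=> //=; rewrite /y dfwith_in.
Qed.
End DirectSum.

(** * Finite-dimensional Hilbert spaces *)

Definition coord_vec (n : nat) : CVec.
Proof.
refine (@Build_CVec ('I_n -> Cx) (fun x y i => Cplus (x i) (y i)) (fun=> C0)
  (fun x i => Copp (x i)) (fun a x i => Cmult a (x i)) _ _ _ _ _ _ _ _);
  move=> *; apply: funext => i; ring.
Defined.

Lemma Cconj_sum n (F : 'I_n -> Cx) : Cconj (\sumC_(i < n) F i) = \sumC_(i < n) Cconj (F i).
Proof. by apply: big_morph => [x y|]; apply: Cx_eq => /=; ring. Qed.

Section CoordHilb.
Variable n : nat.
Implicit Types x y z : coord_vec n.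

Definition coord_inner x y : Cx := \sumC_(i < n) Cmult (x i) (Cconj (y i)).

Lemma coord_innerD x y z :
  coord_inner (vadd x y) z = Cplus (coord_inner x z) (coord_inner y z).
Proof. by rewrite /coord_inner -big_split; apply: eq_bigr => i _ /=; ring. Qed.

Lemma coord_innerZ a x y : coord_inner (vscal a x) y = Cmult a (coord_inner x y).
Proof. by rewrite /coord_inner big_distrr; apply: eq_bigr => i _ /=; ring. Qed.

Lemma coord_innerC x y : coord_inner y x = Cconj (coord_inner x y).
Proof.
by rewrite Cconj_sum; apply: eq_bigr => i _; apply: Cx_eq => /=; ring.
Qed.

Lemma coord_nrm2 x :
  cre (coord_inner x x) = \sumR_(i < n) (cre (x i) * cre (x i) + cim (x i) * cim (x i)).
Proof. by rewrite /coord_inner cre_sum; apply: eq_bigr => i _ /=; ring. Qed.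

Lemma coord_nrm2_ge0 x : 0 <= cre (coord_inner x x).
Proof. by rewrite coord_nrm2; apply: sumR_ge0 => i; nra. Qed.

Lemma coord_le x i :
  cre (x i) * cre (x i) + cim (x i) * cim (x i) <= cre (coord_inner x x).
Proof.
rewrite coord_nrm2 (bigD1 i) //= -{1}[X in X <= _]Rplus_0_r; apply: Rplus_le_compat_l.
by rewrite -big_filter; apply: sumR_ge0 => j; nra.
Qed.

Lemma coord_inner_eq0 x : coord_inner x x = C0 -> x = vzero (coord_vec n).
Proof.
move=> h; apply: funext => i; have := coord_le x i; rewrite h /= => hi.
by apply: Cx_eq => /=; nra.
Qed.

Lemma abs_lt_of_sq v d : 0 < d -> v * v < d * d -> Rabs v < d.
Proof. by move=> d0 h; split_Rabs; nra. Qed.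

Lemma real_cauchy_lim (u : nat -> R) :
  (forall d, 0 < d -> exists N, forall m k, (N <= m)%nat -> (N <= k)%nat ->
    Rabs (u m - u k) < d) ->
  exists l, forall d, 0 < d -> exists N, forall m, (N <= m)%nat -> Rabs (u m - l) < d.
Proof.
move=> h; have [|l hl] := R_complete u.
  move=> d d0; have [N hN] := h d d0; exists N => m k /ssrnat.leP ? /ssrnat.leP ?.
  exact: hN.
exists l => d d0; have [N hN] := hl d d0; exists N => m /ssrnat.leP; exact: hN.
Qed.

Lemma coord_complete (u : nat -> coord_vec n) :
  (forall d, 0 < d -> exists N, forall m k, (N <= m)%nat -> (N <= k)%nat ->
    let w := vadd (u m) (vopp (u k)) in sqrt (cre (coord_inner w w)) < d) ->
  exists l : coord_vec n, forall d, 0 < d -> exists N, forall m, (N <= m)%nat ->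
    let w := vadd (u m) (vopp l) in sqrt (cre (coord_inner w w)) < d.
Proof.
move=> cau.
have bnd i d m k : 0 < d ->
    (let w := vadd (u m) (vopp (u k)) in sqrt (cre (coord_inner w w)) < d) ->
    Rabs (cre (u m i) - cre (u k i)) < d /\ Rabs (cim (u m i) - cim (u k i)) < d.
  move=> d0; set w := vadd (u m) (vopp (u k)) => /= /(sqrt_lt_sq _ d0) hw.
  have := coord_le w i; set Q := cre (coord_inner w w) in hw *.
  rewrite /w /= => hi; have := Rle_0_sqr (cre (u m i) - cre (u k i)).
  have := Rle_0_sqr (cim (u m i) - cim (u k i)); rewrite /Rsqr /Rminus => *.
  by split; apply: abs_lt_of_sq => //; clearbody Q; lra.
have limr i : exists l, forall d, 0 < d -> exists N, forall m, (N <= m)%nat ->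
    Rabs (cre (u m i) - l) < d.
  apply: real_cauchy_lim => d d0; have [N hN] := cau d d0; exists N => m k Nm Nk.
  exact: (bnd i d m k d0 (hN m k Nm Nk)).1.
have limi i : exists l, forall d, 0 < d -> exists N, forall m, (N <= m)%nat ->
    Rabs (cim (u m i) - l) < d.
  apply: real_cauchy_lim => d d0; have [N hN] := cau d d0; exists N => m k Nm Nk.
  exact: (bnd i d m k d0 (hN m k Nm Nk)).2.
have [lr hr] := choice limr; have [li hi] := choice limi.
pose l : coord_vec n := fun i => mkC (lr i) (li i).
exists l => d d0.
pose a i m := (cre (u m i) - lr i) * (cre (u m i) - lr i)
              + (cim (u m i) - li i) * (cim (u m i) - li i).
have [i c c0||N hN] := @eventually_sum_le _ (index_enum 'I_n) a _ (d * d).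
(* [|v| < b <= 1] gives [v^2 < b <= c / 2], and each coordinate contributes two such squares. *)
- pose b := Rmin 1 (c / 2).
  have b0 : 0 < b by apply: Rmin_glb_lt; lra.
  have b1 : b <= 1 by exact: Rmin_l.
  have bc : b <= c / 2 by exact: Rmin_r.
  have [N1 h1] := hr i b b0; have [N2 h2] := hi i b b0.
  exists (maxn N1 N2) => m; rewrite geq_max => /andP[/h1 + /h2].
  have sq v : Rabs v < b -> v * v < c / 2 by split_Rabs; nra.
  by move=> /sq s1 /sq s2; rewrite /a; lra.
- nra.
exists N => m Nm /=; rewrite sqrt_lt_sq //; apply: Rle_lt_trans (hN m Nm).
by rewrite coord_nrm2; right; apply: eq_bigr => i _; rewrite /a /=; ring.
Qed.

Definition coord_hilb : Hilb :=
  @Build_Hilb (coord_vec n) coord_inner coord_innerD coord_innerZ coord_innerC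
    coord_nrm2_ge0 coord_inner_eq0 coord_complete.
End CoordHilb.

(** * Representations from positive families of sesquilinear forms *)

Section Forms.
Variables (Z : CVec) (K : forall n, mat Z n -> Prop) (e : Z) (V : CVec).
Variable B : Z -> V -> V -> Cx.
Hypothesis He : accretive_unit K e.
Hypothesis BzD : forall z w x y, B (vadd z w) x y = Cplus (B z x y) (B w x y).
Hypothesis BzZ : forall a z x y, B (vscal a z) x y = Cmult a (B z x y).
Hypothesis BlD : forall z x x' y, B z (vadd x x') y = Cplus (B z x y) (B z x' y).
Hypothesis BlZ : forall a z x y, B z (vscal a x) y = Cmult (Cconj a) (B z x y).
Hypothesis BrD : forall z x y y', B z x (vadd y y') = Cplus (B z x y) (B z x y').
Hypothesis BrZ : forall a z x y, B z x (vscal a y) = Cmult a (B z x y).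
Hypothesis Bpos : forall n, (0 < n)%N -> forall A : mat Z n, K A -> forall u : 'I_n -> V,
  0 <= \sumR_(i < n) \sumR_(j < n) cre (B (A i j) (u i) (u j)).

Lemma form0l z y : B z (vzero V) y = C0.
Proof. by rewrite -(vscal0 (vzero V)) BlZ; apply: Cx_eq => /=; ring. Qed.

Lemma form0r z x : B z x (vzero V) = C0.
Proof. by rewrite -(vscal0 (vzero V)) BrZ; apply: Cx_eq => /=; ring. Qed.

Lemma form_suml z n (F : 'I_n -> V) y :
  B z (\sumV_(i < n) F i) y = \sumC_(i < n) B z (F i) y.
Proof. by elim/big_rec2: _ => [|i a b _ <-]; rewrite ?BlD ?form0l. Qed.

Lemma form_sumr z n (F : 'I_n -> V) x :
  B z x (\sumV_(i < n) F i) = \sumC_(i < n) B z x (F i).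
Proof. by elim/big_rec2: _ => [|i a b _ <-]; rewrite ?BrD ?form0r. Qed.

Lemma form_pos1 (A : mat Z 1) x : K A -> 0 <= cre (B (A ord0 ord0) x x).
Proof.
by move=> KA; have := Bpos (ltn0Sn 0) KA (fun=> x); rewrite !big_ord1.
Qed.

Lemma form_unit_ge0 x : 0 <= cre (B e x x).
Proof.
have [_ h] := He; have [t [t0 Kt]] := h 1%N isT (fun _ _ => vzero Z).
have := form_pos1 x Kt; rewrite /madd /mscal /eI eqxx vadd0 BzZ /= => hB.
by apply: (Rmult_le_reg_l t) => //; lra.
Qed.

(** Writing [e = i c = - i d] with [c] and [d] accretive, the imaginary part is [Re B c >= 0] and
    also [- Re B d <= 0]. *)
Lemma form_unit_real x : cim (B e x x) = 0.
Proof.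
have [[[c [Kc Ec]] [d [Kd Ed]]] _] := He.
have := form_pos1 x Kc; have := form_pos1 x Kd.
have Ee : e = vscal Ci (c ord0 ord0) by rewrite -[RHS]/(mscal Ci c ord0 ord0) -Ec.
have Ee' : e = vscal (Copp Ci) (d ord0 ord0).
  by rewrite -[RHS]/(mscal (Copp Ci) d ord0 ord0) -Ed.
have := congr1 (fun z => cim (B z x x)) Ee; have := congr1 (fun z => cim (B z x x)) Ee'.
rewrite !BzZ /=; lra.
Qed.

Lemma form_unit_herm x y : B e y x = Cconj (B e x y).
Proof.
have h1 := form_unit_real (vadd x y).
have h2 := form_unit_real (vadd x (vscal Ci y)).
move: h1 h2 (form_unit_real x) (form_unit_real y).
rewrite !(BlD, BrD, BlZ, BrZ) /= => *; apply: Cx_eq => /=; lra.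
Qed.

Lemma linear_ge0 (a b : R) : (forall s, 0 <= s -> 0 <= a + s * b) -> 0 <= b.
Proof.
move=> h; apply: Rnot_lt_le => b0.
have s0 : 0 <= (Rabs a + 1) / - b.
  by apply: Rmult_le_pos; [have := Rabs_pos a; lra | left; apply: Rinv_0_lt_compat; lra].
have := h _ s0; have -> : (Rabs a + 1) / - b * b = - (Rabs a + 1) by field; lra.
by split_Rabs; lra.
Qed.

(** A substitute for Cauchy-Schwarz, as [B z] has no sign: the order unit property is applied to the
    2-by-2 matrix with [z] in its upper right corner. *)
Lemma form_offdiag z : exists t, forall x y,
  0 <= t * (cre (B e x x) + cre (B e y y)) + cre (B z x y).
Proof.
have [_ h] := He.
pose A : mat Z 2 := fun i j => if (i == ord0) && (j != ord0) then z else vzero Z.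
have [t [_ Kt]] := h 2%N isT A; exists t => x y.
have := Bpos (isT : (0 < 2)%N) Kt (fun i => if i == ord0 then x else y).
rewrite !big_ord_recl !big_ord0 /madd /mscal /eI /A /= !vadd0 !vscalx0 !vadd0x !BzZ /=.
rewrite -(vscal0 (vzero Z)) !BzZ /=; lra.
Qed.

(** Replacing [w] by [s a w] keeps the [e]-term of [w] at zero, so the bound of [form_offdiag] is
    affine in [s] and its slope is nonnegative; taking [a] among 1, -1, i, -i kills both parts of
    the form. *)
Lemma form_null z w y : B e w w = C0 -> B z w y = C0 /\ B z y w = C0.
Proof.
move=> w0; have [t ht] := form_offdiag z.
have null a : B e (vscal a w) (vscal a w) = C0.
  by rewrite BlZ BrZ w0; apply: Cx_eq => /=; ring.
have hl a : 0 <= cre (Cmult (Cconj a) (B z w y)).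
  apply: (@linear_ge0 (t * cre (B e y y))) => s _.
  have := ht (vscal (Cmult (RtoC s) a) w) y; rewrite null BlZ /=; lra.
have hr a : 0 <= cre (Cmult a (B z y w)).
  apply: (@linear_ge0 (t * cre (B e y y))) => s _.
  have := ht y (vscal (Cmult (RtoC s) a) w); rewrite null BrZ /=; lra.
have := hl C1; have := hl (Copp C1); have := hl Ci; have := hl (Copp Ci).
have := hr C1; have := hr (Copp C1); have := hr Ci; have := hr (Copp Ci).
by move=> /= *; split; apply: Cx_eq => /=; lra.
Qed.

Definition orthonormal_fam r (v : 'I_r -> V) : Prop :=
  forall k l, B e (v k) (v l) = if k == l then C1 else C0.

(** The form of [e] may be degenerate, so the rank [r] is not known in advance and each [u i] is
    recovered only up to a null vector. A vector with null residual adds nothing to the family. *)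
Lemma gram_schmidt n (u : 'I_n -> V) : exists r (v : 'I_r -> V), orthonormal_fam v /\
  forall i, exists c : 'I_r -> Cx,
    let w := vadd (u i) (vopp (\sumV_(k < r) vscal (c k) (v k))) in B e w w = C0.
Proof.
elim: n u => [|n IH] u.
  by exists 0%N, (fun=> vzero V); split=> [[]|[]].
have [r [v [von vc]]] := IH (fun i => u (lift ord_max i)).
pose c0 k := B e (v k) (u ord_max).
pose w := vadd (u ord_max) (vopp (\sumV_(k < r) vscal (c0 k) (v k))).
have last_or (i : 'I_n.+1) : i = ord_max \/ exists j, i = lift ord_max j.
  by case: (unliftP ord_max i) => [j ->|->]; [right; exists j | left].
case: (pselect (B e w w = C0)) => [w0|wn0].
  by exists r, v; split=> // i; case: (last_or i) => [->|[j ->]]; [exists c0 | exact: vc].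
have wpos : 0 < cre (B e w w).
  case: (form_unit_ge0 w) => // E; case: wn0.
  by apply: Cx_eq; rewrite /= -?E ?form_unit_real.
pose a := / sqrt (cre (B e w w)); pose w' := vscal (RtoC a) w.
have sq := sqrt_lt_R0 _ wpos.
have w'1 : B e w' w' = C1.
  rewrite BlZ BrZ; apply: Cx_eq => /=; rewrite form_unit_real; last by ring.
  rewrite /a -{3}(sqrt_sqrt (cre (B e w w))); last lra.
  by field; lra.
have vw k : B e (v k) w = C0.
  rewrite BrD voppE BrZ form_sumr (bigD1 k) //= big1 => [|l lk]; rewrite BrZ von.
    by rewrite eqxx /c0; ring.
  by rewrite eq_sym (negbTE lk); ring.
have vw' k : B e (v k) w' = C0 by rewrite BrZ vw; ring.
have w'v k : B e w' (v k) = C0.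
  by rewrite form_unit_herm vw'; apply: Cx_eq => /=; ring.
pose v' (k : 'I_r.+1) := if unlift ord_max k is Some l then v l else w'.
have v'l k : v' (lift ord_max k) = v k by rewrite /v' liftK.
have v'm : v' ord_max = w' by rewrite /v' unlift_none.
exists r.+1, v'; split.
  move=> k l; case: (unliftP ord_max k) => [k' ->|->]; case: (unliftP ord_max l) => [l' ->|->].
  - by rewrite !v'l von (inj_eq lift_inj).
  - by rewrite v'l v'm vw' eq_sym (negbTE (neq_lift _ _)).
  - by rewrite v'l v'm w'v (negbTE (neq_lift _ _)).
  - by rewrite v'm w'1 eqxx.
have ext (c : 'I_r -> Cx) b : exists c' : 'I_r.+1 -> Cx,
    \sumV_(k < r.+1) vscal (c' k) (v' k) = vadd (\sumV_(k < r) vscal (c k) (v k)) (vscal b w').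
  exists (fun k => if unlift ord_max k is Some l then c l else b).
  rewrite (bigD1_ord ord_max) //= unlift_none v'm vaddC; congr vadd.
  by apply: eq_bigr => k _; rewrite liftK v'l.
move=> i; case: (last_or i) => [->|[j ->]].
  (* The coefficient [sqrt (B e w w)] undoes the normalization of [w], so the residual of the last
     vector is exactly zero. *)
  have [c' hc'] := ext c0 (RtoC (sqrt (cre (B e w w)))); exists c'; rewrite /= hc'.
  have -> : vadd (u ord_max) (vopp (vadd (\sumV_(k < r) vscal (c0 k) (v k))
      (vscal (RtoC (sqrt (cre (B e w w)))) w'))) = vzero V.
    rewrite /w' /a; move: sq; set q := sqrt _; clearbody q => q0.
    rewrite /w; vec_eq.
  exact: form0l.
have [c hc] := vc j; have [c' hc'] := ext c C0; exists c'.
by rewrite /= hc' vscal0 vadd0.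
Qed.

(* Compress the form to an orthonormal basis of the span of [u] modulo null vectors. *)
Lemma form_representation n (u : 'I_n -> V) :
  exists (H : Hilb) (T : Z -> H -> H), unital_positive K e T /\
  exists c : 'I_n -> H, forall A : mat Z n,
    quad (ampl T A) c = \sumR_(i < n) \sumR_(j < n) cre (B (A i j) (u i) (u j)).
Proof.
have [r [v [von vc]]] := gram_schmidt u.
pose span (x : coord_hilb r) := \sumV_(k < r) vscal (x k) (v k).
pose T z (x : coord_hilb r) : coord_hilb r := fun k => \sumC_(l < r) Cmult (x l) (B z (v k) (v l)).
(* The arguments are swapped because [hinner] is linear in its first argument and [B] in its
   second. *)
have TE z x y : hinner (T z x) y = B z (span y) (span x).
  rewrite form_suml; apply: eq_bigr => k _; rewrite BlZ form_sumr.
  by rewrite big_distrl /= big_distrr; apply: eq_bigr => l _ /=; rewrite BrZ; ring.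
have [c hc] := choice vc.
exists (coord_hilb r), T; split.
  split.
  - split=> [z w h|a z h]; apply: funext => k; rewrite /T /=.
      by rewrite -big_split; apply: eq_bigr => l _ /=; rewrite BzD; ring.
    by rewrite big_distrr; apply: eq_bigr => l _ /=; rewrite BzZ; ring.
  - move=> z; split=> [x y|a x]; apply: funext => k; rewrite /T /=.
      by rewrite -big_split; apply: eq_bigr => l _ /=; ring.
    by rewrite big_distrr; apply: eq_bigr => l _ /=; ring.
  - move=> h; apply: funext => k; rewrite /T (bigD1 k) //= big1 => [|l lk]; rewrite von.
      by rewrite eqxx; ring.
    by rewrite eq_sym (negbTE lk); ring.
  - move=> m m0 A KA; apply/op_accretiveE => x.
    have := Bpos m0 KA (fun i => span (x i)).
    by under eq_bigr do under eq_bigr do rewrite -TE.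
exists c => A; apply: eq_bigr => i _; apply: eq_bigr => j _; rewrite /ampl TE.
(* The residual [w i] is null for the form of [e], hence invisible to every form, so [u i] may be
   replaced by its projection. *)
pose w i := vadd (u i) (vopp (span (c i))).
have uE k : u k = vadd (span (c k)) (w k) by rewrite /w; vec_eq.
have hl k z y : B z (w k) y = C0 by case: (form_null z y (hc k)).
have hr k z y : B z y (w k) = C0 by case: (form_null z y (hc k)).
by clearbody w; rewrite (uE i) (uE j) !(BlD, BrD) !hl !hr /=; ring.
Qed.
End Forms.

(** * Matrix-ordered spaces *)

Definition mat_vec (Z : CVec) (n : nat) : CVec.
Proof.
refine (@Build_CVec (mat Z n) (@madd Z n) (fun _ _ => vzero Z) (@mopp Z n) (@mscal Z n)
  _ _ _ _ _ _ _ _); move=> *; apply: funext => i; apply: funext => j;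
  rewrite /madd /mscal /mopp.
- exact: vaddA.
- exact: vaddC.
- exact: vadd0.
- exact: vaddN.
- exact: vscal1.
- exact: vscalA.
- exact: vscalDr.
- exact: vscalDl.
Defined.

Lemma mat_sumE (Z : CVec) n m (F : 'I_m -> mat_vec Z n) p q :
  (\sumV_(i < m) F i) p q = \sumV_(i < m) F i p q.
Proof. exact: (big_morph (fun A : mat_vec Z n => A p q)). Qed.

Section Space.
Variables (Z : CVec) (K : forall n, mat Z n -> Prop) (e : Z).
Hypotheses (HK : matrix_cone K) (He : accretive_unit K e) (Harch : archimedean K e).

Definition sandwich n (z : Z) (x y : coord_vec n) : mat_vec Z n :=
  fun i j => vscal (Cmult (Cconj (x i)) (y j)) z.

Lemma congr_sandwich n m (A : mat Z m) (u : 'I_m -> coord_vec n) :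
  congr u A = \sumV_(i < m) \sumV_(j < m) sandwich (A i j) (u i) (u j).
Proof.
apply: funext => p; apply: funext => q; rewrite mat_sumE; apply: eq_bigr => i _.
by rewrite mat_sumE.
Qed.

Lemma congr_id n (A : mat Z n) : congr (fun i j => if i == j then C1 else C0) A = A.
Proof.
apply: funext => p; apply: funext => q; rewrite /congr (bigD1 p) //= (bigD1 q) //=.
rewrite !eqxx !big1.
- by rewrite !vadd0 -[RHS]vscal1; congr vscal; apply: Cx_eq => /=; ring.
- by move=> i ip; rewrite big1 // => j _; rewrite (negbTE ip) -(vscal0 (A i j)); congr vscal;
    apply: Cx_eq => /=; ring.
- by move=> j jq; rewrite (negbTE jq) -(vscal0 (A p j)); congr vscal; ring.
Qed.

Lemma separating_rep n (z0 : mat Z n) : (0 < n)%N -> ~ K z0 ->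
  exists (H : Hilb) (T : Z -> H -> H),
    unital_positive K e T /\ ~ op_accretive (ampl T z0).
Proof.
move=> n0 nK; have [t [t0 nKt]] : exists t, 0 < t /\ ~ K (madd (mscal (RtoC t) (eI e n)) z0).
  apply: contrapT => h; apply/nK/Harch => // t t0; apply: contrapT => nKt.
  by apply: h; exists t.
have [f [fD fZ fpos f0]] := @cone_separation (mat_vec Z n) (@K n) (eI e n)
  (HK.1 n n0) (He.2 n n0) z0 t t0 nKt.
have fsum m (F : 'I_m -> mat_vec Z n) : f (\sumV_(i < m) F i) = \sumR_(i < m) f (F i).
  apply: (big_morph f) => // ; rewrite -(vscal0 (vzero (mat_vec Z n))).
  by have := fZ 0 (vzero (mat_vec Z n)); rewrite Rmult_0_l.
(* The complex-linear functional with real part [f]. *)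
pose g (A : mat_vec Z n) := mkC (f A) (- f (vscal Ci A)).
have gD A A' : g (vadd A A') = Cplus (g A) (g A').
  have hi : vscal Ci (vadd A A') = vadd (vscal Ci A) (vscal Ci A') by exact: vscalDr.
  apply: Cx_eq; first exact: fD.
  by rewrite -[LHS]/(- f (vscal Ci (vadd A A'))) hi fD /=; ring.
have gZ a A : g (vscal a A) = Cmult a (g A).
  apply: Cx_eq.
    have E : vscal a A = vadd (vscal (RtoC (cre a)) A) (vscal (RtoC (cim a)) (vscal Ci A)).
      by vec_eq.
    by rewrite -[LHS]/(f (vscal a A)) E fD !fZ /=; ring.
  have E : vscal Ci (vscal a A) =
      vadd (vscal (RtoC (cre a)) (vscal Ci A)) (vscal (RtoC (- cim a)) A) by vec_eq.
  by rewrite -[LHS]/(- f (vscal Ci (vscal a A))) E fD !fZ /=; ring.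
pose B z (x y : coord_vec n) := g (sandwich z x y).
have BE m (A : mat Z m) (u : 'I_m -> coord_vec n) :
    \sumR_(i < m) \sumR_(j < m) cre (B (A i j) (u i) (u j)) = f (congr u A).
  by rewrite congr_sandwich fsum; apply: eq_bigr => i _; rewrite fsum.
have sandE (A A' : mat_vec Z n) : (forall i j, A i j = A' i j) -> A = A'.
  by move=> h; apply: funext => i; apply: funext => j; exact: h.
(* The vectors are the standard basis of [C^n], for which [congr] is the identity; the resulting
   quadratic form at [z0] is therefore [f z0 < 0]. *)
have [||||||m m0 A KA u|H [T [Trep [c hc]]]] :=
  @form_representation Z K e (coord_vec n) B He _ _ _ _ _ _ _ n
    (fun i j => if i == j then C1 else C0).
- move=> z w x y; rewrite /B -gD; congr g; apply: sandE => i j; exact: vscalDr.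
- move=> a z x y; rewrite /B -gZ; congr g; apply: sandE => i j.
  by rewrite /sandwich /= /mscal !vscalA; congr vscal; ring.
- move=> z x x' y; rewrite /B -gD; congr g; apply: sandE => i j.
  by rewrite /sandwich /= /madd -vscalDl; congr vscal; apply: Cx_eq => /=; ring.
- move=> a z x y; rewrite /B -gZ; congr g; apply: sandE => i j.
  by rewrite /sandwich /= /mscal !vscalA; congr vscal; apply: Cx_eq => /=; ring.
- move=> z x y y'; rewrite /B -gD; congr g; apply: sandE => i j.
  by rewrite /sandwich /= /madd -vscalDl; congr vscal; ring.
- move=> a z x y; rewrite /B -gZ; congr g; apply: sandE => i j.
  by rewrite /sandwich /= /mscal !vscalA; congr vscal; ring.
- by rewrite BE; apply/fpos/HK.2.
exists H, T; split=> // /op_accretiveE /(_ c).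
by rewrite hc BE congr_id; lra.
Qed.

Lemma unit_norm_set_ex n (z : mat Z n) : (0 < n)%N -> exists t, unit_norm_set K e z t.
Proof.
by move=> n0; apply: He.2; rewrite addn_gt0 n0.
Qed.

(** The bound is chosen before the representation; this uniformity is what makes the direct sum of
    representations well defined. *)
Lemma rep_bound z : exists t, forall (H : Hilb) (T : Z -> H -> H),
  unital_positive K e T -> forall x, nrm2 (T z x) <= t * nrm2 x.
Proof.
have [t ht] := unit_norm_set_ex (m1 z) (ltn0Sn 0); exists (t * t) => H T rT x.
have := rep_norm_le rT (ltn0Sn 0) ht (fun=> x).
by rewrite /normsq_n !big_ord1 /opapp big_ord1.
Qed.

(** * Direct sums of representations *)

Section Sum.
Variables (J : choiceType) (E : J -> Hilb) (T : forall j, Z -> E j -> E j).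
Hypothesis T_rep : forall j, unital_positive K e (@T j).

Lemma sum_rep_summable z (x : dsum_hilb E) : sq_summable (fun j => T z (sval x j)).
Proof.
have [t ht] := rep_bound z; have [s hs] := svalP x.
apply: summable_le (ex_intro _ _ (has_sumZ t hs)) => j.
by split; [exact: nrm2_ge0 | exact: ht].
Qed.

Definition sum_rep z (x : dsum_hilb E) : dsum_hilb E := exist _ _ (sum_rep_summable z x).

Lemma sum_rep_quad n (A : mat Z n) (x : 'I_n -> dsum_hilb E) :
  has_sum (fun j => quad (ampl (@T j) A) (fun i => sval (x i) j))
          (quad (ampl sum_rep A) x).
Proof.
apply: has_sum_big => p; apply: has_sum_big => q.
exact: summableP (summable_re (sum_rep (A p q) (x q)) (x p)).
Qed.

Lemma sum_rep_unital_positive : unital_positive K e sum_rep.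
Proof.
split.
- by split=> [z w x|a z x]; apply: dsum_eq => j; have [[h1 h2] _ _ _] := T_rep j;
    rewrite /= ?h1 ?h2.
- by move=> z; split=> [x y|a x]; apply: dsum_eq => j; have [_ h _ _] := T_rep j;
    rewrite /= ?(h _).1 ?(h _).2.
- by move=> x; apply: dsum_eq => j; have [_ _ h _] := T_rep j; rewrite /= h.
- move=> n n0 A KA; apply/op_accretiveE => x; apply: has_sum_ge0 (sum_rep_quad A x) => j.
  by have [_ _ _ h] := T_rep j; have /op_accretiveE := h n n0 A KA; apply.
Qed.

(** Test on vectors supported in the single component [j], where the sum of the quadratic forms has
    one term. *)
Lemma sum_rep_component n (A : mat Z n) j :
  op_accretive (ampl sum_rep A) -> op_accretive (ampl (@T j) A).
Proof.
move=> /op_accretiveE h; apply/op_accretiveE => x.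
have [y hy] := choice (fun i => dsum_inj_ex (x i)).
have := h y; have := sum_rep_quad A y.
have -> : quad (ampl (@T j) A) x = quad (ampl (@T j) A) (fun i => sval (y i) j).
  by congr quad; apply: funext => i; rewrite (hy i).1.
move=> /has_sum_uniq /(_ (@has_sum_single _ _ j _)) -> // k kj.
apply: big1 => p _; apply: big1 => q _; have [_ y0] := hy p.
by rewrite y0 // hinnerC hinner0l.
Qed.
End Sum.

Lemma exists_order_rep : exists (H : Hilb) (phi : Z -> H -> H),
  unital_positive K e phi /\
  forall n, (0 < n)%N -> forall z : mat Z n, op_accretive (ampl phi z) -> K z.
Proof.
pose J := {p : {n & mat Z n} | (0 < projT1 p)%N /\ ~ K (projT2 p)}.
have sep (j : J) : {H : Hilb & {T : Z -> H -> H |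
    unital_positive K e T /\ ~ op_accretive (ampl T (projT2 (sval j)))}}.
  have [H h] := cid (separating_rep (svalP j).1 (svalP j).2).
  by exists H; exact: cid h.
(* [{classic J}] equips the index type with the choice structure that unordered sums require. *)
pose E (j : {classic J}) := projT1 (sep j).
pose T (j : {classic J}) : Z -> E j -> E j := sval (projT2 (sep j)).
have T_rep j : unital_positive K e (T j) by have [] := svalP (projT2 (sep j)).
exists (dsum_hilb E), (sum_rep T_rep); split; first exact: sum_rep_unital_positive.
move=> n n0 z hz; apply: contrapT => nK.
pose j : J := exist _ (existT (fun n => mat Z n) n z) (conj n0 nK).
have [_] := svalP (projT2 (sep j)); apply.
exact: (@sum_rep_component _ _ _ T_rep n z j hz).
Qed.

(** * Boundedness, injectivity and isometry of an order embedding *)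

Section Isometry.
Variables (H : Hilb) (phi : Z -> H -> H).
Hypothesis phi_rep : unital_positive K e phi.
Hypothesis phi_order :
  forall n, (0 < n)%N -> forall z : mat Z n, op_accretive (ampl phi z) -> K z.

Lemma rep_bounded_linear z : bounded_linear (phi z).
Proof.
have [_ h _ _] := phi_rep; have [h1 h2] := h z; split=> //; split=> //.
(* [rep_bound] does not record the sign of [t], so it is cut off at 0 before splitting the square
   root. *)
have [t ht] := rep_bound z; exists (sqrt (Rmax t 0)) => x.
rewrite /hnorm -sqrt_mult; [|exact: Rmax_r|exact: hinner_ge0].
apply: sqrt_le_1_alt; apply: Rle_trans (ht _ _ phi_rep x) _.
by apply: Rmult_le_compat_r; [exact: nrm2_ge0 | exact: Rmax_l].
Qed.

(** All complex multiples of [z - w] are sent to the accretive operator 0, so order reflection puts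
    them in the cone, and properness leaves only 0. *)
Lemma rep_injective (Hprop : C_proper K) z w : (forall h, phi z h = phi w h) -> z = w.
Proof.
move=> zw; have [[phiD phiZ] _ _ _] := phi_rep.
pose a : mat Z 1 := m1 (vadd z (vopp w)).
have Ka c : K (mscal c a).
  apply: phi_order => //; apply/op_accretiveE => x; rewrite /quad !big_ord1.
  rewrite /ampl /mscal /a /m1 phiZ phiD (rep_vopp phi_rep) zw vaddN vscalx0 hinner0l.
  exact: Rle_refl.
have aE c d : Cmult c d = C1 -> a = mscal c (mscal d a).
  move=> cd; apply: funext => i; apply: funext => j.
  by rewrite /mscal vscalA cd vscal1.
have Ea : a = m1 (vzero Z).
  apply/Hprop; split; [|split; [|split]].
  - have <- : mscal C1 a = a by apply: funext => i; apply: funext => j; exact: vscal1.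
    exact: Ka.
  - by exists (mscal (Copp C1) a); split; [exact: Ka | apply: aE; ring].
  - by exists (mscal (Copp Ci) a); split; [exact: Ka | apply: aE; apply: Cx_eq => /=; ring].
  - by exists (mscal Ci a); split; [exact: Ka | apply: aE; apply: Cx_eq => /=; ring].
have : vadd z (vopp w) = vzero Z by rewrite -[LHS]/(a ord0 ord0) Ea.
move=> h; apply: (@vadd_cancel _ (vopp w)).
by rewrite (vaddC _ z) h vaddC vaddN.
Qed.

(** Every [t] in the unit-norm set bounds the operator norm [r]. Conversely every [t > r] is in that
    set: the norm bound makes the block operator accretive, and order reflection brings this back to
    [K]. *)
Lemma rep_complete_isometry : complete_isometry K e phi.
Proof.
move=> n n0 z; pose P x := normsq_n (opapp (ampl phi z) x).
have unit_le t : unit_norm_set K e z t -> forall x, P x <= t * t * normsq_n x.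
  exact: rep_norm_le.
have ub t : unit_norm_set K e z t -> is_upper_bound (op_norm_set (ampl phi z)) t.
  move=> ht _ [x [x1 ->]]; have t0 := ht.1; rewrite -(sqrt_square t); last lra.
  apply: sqrt_le_1_alt; apply: Rle_trans (unit_le t ht x) _.
  by rewrite -{2}(Rmult_1_r (t * t)); apply: Rmult_le_compat_l => //; nra.
have [t1 ht1] := unit_norm_set_ex z n0.
have ne0 : op_norm_set (ampl phi z) 0.
  have n00 : normsq_n ((fun=> vzero H) : 'I_n -> H) = 0.
    by apply: big1 => i _; rewrite hinner0l.
  exists (fun=> vzero H); rewrite n00; split; first lra.
  have -> : normsq_n (opapp (ampl phi z) (fun=> vzero H)) = 0; last by rewrite sqrt_0.
  apply: Rle_antisym; last exact: normsq_ge0.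
  by have := unit_le t1 ht1 (fun=> vzero H); rewrite n00 Rmult_0_r.
have [r [rub rlub]] := completeness _ (ex_intro _ _ (ub t1 ht1)) (ex_intro _ _ ne0).
exists r; split=> //; split=> [t ht|b hb]; first exact: rlub (ub t ht).
have r0 : 0 <= r by apply: rub.
(* The midpoint exceeds [r], hence is positive even when [r = 0], and lies below the supposed lower
   bound [b]. *)
apply: Rnot_lt_le => rb; pose t := (r + b) / 2.
have t0 : 0 < t by rewrite /t; lra.
suff : unit_norm_set K e z t by move/hb; rewrite /t; lra.
split=> //; apply: phi_order; first by rewrite addn_gt0 n0.
apply: (rep_norm_accretive phi_rep) => // x.
(* A vector of norm zero cannot be normalized; there the crude bound by [t1] already gives zero. *)
case: (normsq_ge0 x) => [x0|x0]; last first.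
  by apply: Rle_trans (unit_le t1 ht1 x) _; rewrite -x0; lra.
pose s := / sqrt (normsq_n x); have sq := sqrt_lt_R0 _ x0.
have ss : s * s * normsq_n x = 1.
  by rewrite /s -{3}(sqrt_sqrt (normsq_n x)); [field|]; lra.
have : sqrt (P (fun i => vscal (RtoC s) (x i))) <= r.
  by apply: rub; exists (fun i => vscal (RtoC s) (x i)); rewrite normsqZ ss; split=> //; lra.
have -> : P (fun i => vscal (RtoC s) (x i)) = s * s * P x.
  by rewrite /P -normsqZ; congr normsq_n; apply: funext => i; exact: (opappZ phi_rep).
have P0 : 0 <= P x by exact: normsq_ge0.
move=> hr; have sP : 0 <= s * s * P x by apply: Rmult_le_pos => //; nra.
have {}hr : s * s * P x <= t * t.
  have := sqrt_sqrt _ sP; have := sqrt_pos (s * s * P x).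
  by rewrite /t in t0 *; nra.
have := Rmult_le_compat_r _ _ _ (Rlt_le _ _ x0) hr.
have -> // : s * s * P x * normsq_n x = P x.
have -> : s * s * P x * normsq_n x = s * s * normsq_n x * P x by ring.
by rewrite ss Rmult_1_l.
Qed.
End Isometry.
End Space.

Theorem theorem3p4 (Z : CVec) (K : forall n, mat Z n -> Prop) (e : Z)
  (HK : matrix_cone K) (Hprop : C_proper K)
  (He : accretive_unit K e) (Harch : archimedean K e) :
  exists (H : Hilb) (phi : Z -> H -> H),
    clinear phi /\
    (forall z, bounded_linear (phi z)) /\
    real_complete_order_embedding K phi /\
    (forall h, phi e h = h) /\
    complete_isometry K e phi.
Proof.
have [H [phi [rep ord]]] := exists_order_rep HK He Harch.
have [lin _ unit pos] := rep.
exists H, phi; split=> //.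
split; first by move=> z; apply: (rep_bounded_linear He rep).
split; first by split; [move=> z w; apply: rep_injective rep ord Hprop _ _ | split].
by split=> //; exact: rep_complete_isometry.
Qed.
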